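(* Let $k$ be a field of characteristic $p$, $G$ a profinite group and $B$ a block of $G$ over $k$. The defect groups of $B$ form a single $G$-conjugacy class of pro-$p$ subgroups of $G$.
   Context: $k$ is a discrete field of prime characteristic $p$. For a profinite group $G$, $k[[G]]=\varprojlim_N k[G/N]$ ($N$ running over open normal subgroups) is the completed group algebra. There is a unique set $E$ of pairwise orthogonal primitive idempotents of $Z(k[[G]])$ with $k[[G]]=\prod_{e\in E}k[[G]]e$; the $k[[G]]e$ are the blocks of $G$ and the $e\in E$ the block idempotents. $G$ acts on $k[[G]]$ by conjugation, ${}^g x=gxg^{-1}$; $k[[G]]^H$ denotes the fixed points of a closed subgroup $H$. For $H$ open in $G$, $\mathrm{Tr}_H^G:k[[G]]^H\to k[[G]]^G$ is $a\mapsto\sum_{g\in G/H}{}^g a$. For $H\le G$ closed, $\mathrm{oTr}_H^G(k[[G]]^H)=\bigcap_{N}\mathrm{Tr}_{HN}^G(k[[G]]^{HN})$, over all open normal subgroups $N$ of $G$. A defect group of a block with block idempotent $e$ is a closed subgroup $D$ of $G$ with $e\in \mathrm{oTr}_D^G(k[[G]]^D)$ and minimal (under inclusion, among closed subgroups) with this property. *)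

(* Defs.v *)
From HB Require Import structures.
From mathcomp Require Import all_boot all_order all_algebra fingroup.
From mathcomp Require Import generic_quotient finmap.
From mathcomp Require Import boolp classical_sets functions cardinality fsbigop.
From mathcomp Require Import topology.

Set Implicit Arguments.
Unset Strict Implicit.
Unset Printing Implicit Defensive.

Import GRing.Theory.
Local Open Scope classical_set_scope.
Local Open Scope ring_scope.

HB.mixin Record isTopologicalGroup G & monoid.Group G & Topological G := {
  mulg_continuous : continuous (fun xy : G * G => (xy.1 * xy.2)%g);
  invg_continuous : continuous (fun x : G => x^-1%g)
}.

#[short(type="topologicalGroupType")]
HB.structure Definition TopologicalGroup :=
  {G of isTopologicalGroup G & monoid.Group G & Topological G}.

HB.mixin Record isProfinite G & TopologicalGroup G := {
  profinite_compact : compact [set: G];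
  profinite_hausdorff : hausdorff_space G;
  profinite_totally_disconnected : totally_disconnected [set: G]
}.

#[short(type="profiniteGroupType")]
HB.structure Definition ProfiniteGroup :=
  {G of isProfinite G & TopologicalGroup G}.

Section Subgroups.
Variable G : groupType.
Implicit Types (g : G) (H K N : set G).

Definition is_subgroup H := group_closed (mem H).

Definition left_coset H g : set G := [set (g * h)%g | h in H].

Definition left_cosets K H : set (set G) := left_coset H @` K.

Definition mulset H N : set G := [set (h * n)%g | h in H & n in N].

Definition conjset g H : set G := [set (g * h * g^-1)%g | h in H].

Definition is_normal_in K H := forall g, K g -> conjset g H `<=` H.

End Subgroups.

Record openNormal (G : topologicalGroupType) := OpenNormal {
  openNormal_set :> set G;
  openNormal_group : is_subgroup openNormal_set;
  openNormal_open : open openNormal_set;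
  openNormal_normal : is_normal_in [set: G] openNormal_set
}.

Section SubgroupFacts.
Variable G : groupType.
Implicit Types (g : G) (H : set G).

Lemma is_subgroup1 H : is_subgroup H -> H 1%g.
Proof. by case; rewrite inE. Qed.

Lemma is_subgroupV H g : is_subgroup H -> H g -> H g^-1%g.
Proof.
by move=> sH Hg; have := group_closedV sH; move=> /(_ g); rewrite !inE; apply.
Qed.

Lemma is_subgroupM H g h : is_subgroup H -> H g -> H h -> H (g * h)%g.
Proof.
by move=> sH Hg Hh; have := group_closedM sH; move=> /(_ g h); rewrite !inE; apply.
Qed.

End SubgroupFacts.

Section Quotient.
Variables (G : profiniteGroupType) (N : openNormal G).

Definition coset_rel (x y : G) : bool := `[< openNormal_set N (x^-1 * y)%g >].

Lemma coset_rel_equiv : equiv_class_of coset_rel.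
Proof.
have sN := openNormal_group N.
have sym x y : coset_rel x y -> coset_rel y x.
  move=> /asboolP Nxy; apply/asboolP.
  by rewrite -(invgK x) -invgM; apply: is_subgroupV.
split; first by move=> x; apply/asboolP; rewrite mulVg; apply: is_subgroup1.
  by move=> x y; apply/idP/idP; apply: sym.
move=> y x z /asboolP Nxy /asboolP Nyz; apply/asboolP.
have -> : (x^-1 * z = (x^-1 * y) * (y^-1 * z))%g by rewrite mulgA mulgK.
exact: is_subgroupM.
Qed.

Canonical coset_equiv := EquivRelPack coset_rel_equiv.

Definition quot := {eq_quot coset_equiv}%qT.
HB.instance Definition _ := Choice.on quot.
HB.instance Definition _ := EqQuotient.on quot.

Definition quot_pi (x : G) : quot := \pi_quot%qT x.
Definition quot_repr (q : quot) : G := repr q.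

Lemma quot_reprK : cancel quot_repr quot_pi.
Proof. exact: reprK. Qed.

Lemma quot_piP (x y : G) : quot_pi x = quot_pi y <-> openNormal_set N (x^-1 * y)%g.
Proof.
split; first by move=> /eqmodP /asboolP.
by move=> Nxy; apply/eqmodP/asboolP.
Qed.

Lemma quot_finite : finite_set [set: quot].
Proof.
have sN := openNormal_group N.
have openc (x : G) : open ((fun y => x^-1 * y)%g @^-1` N).
  apply: open_comp; last exact: openNormal_open.
  move=> y _.
  apply: (@continuous_comp _ _ _ (fun z : G => (x^-1%g, z))
                                 (fun xy : G * G => (xy.1 * xy.2)%g)).
    by apply: cvg_pair => /=; [exact: cvg_cst|exact: cvg_id].
  exact: mulg_continuous.
pose pG : ptopologicalType := HB.pack_for ptopologicalType (G : Type)
  (Topological.on G) (isPointed.Build (G : Type) 1%g).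
have := @profinite_compact G.
rewrite -[@compact _]/(@compact pG) compact_cover => cG.
have [|D _ Dcov] := cG G setT _ (fun x _ => openc x).
  by move=> x _; exists x => //=; rewrite mulVg; apply: is_subgroup1.
have finD : finite_set (quot_pi @` [set` D]) by exact/finite_image/finite_fset.
apply: sub_finite_set finD.
  move=> q _; have [x xD /= Nx] := Dcov (quot_repr q) I.
  by exists x => //; rewrite -[q]quot_reprK; apply/quot_piP.

Qed.

Definition quot_enum : seq quot := fset_set [set: quot].

Lemma mem_quot_enum q : q \in quot_enum.
Proof. by rewrite /quot_enum in_fset_set ?inE//; exact: quot_finite. Qed.

Lemma quot_pickleK :
  pcancel (index^~ quot_enum) (fun i => onth quot_enum i).
Proof.
move=> q; apply/eqP.
by rewrite onthE (nth_map q) ?index_mem ?mem_quot_enum// nth_index ?mem_quot_enum.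
Qed.
HB.instance Definition _ := Choice_isCountable.Build quot quot_pickleK.

Lemma quot_enumP : Finite.axiom quot_enum.
Proof. by move=> q; rewrite count_uniq_mem ?mem_quot_enum ?fset_uniq. Qed.
HB.instance Definition _ := isFinite.Build quot quot_enumP.

Definition quot_mul (a b : quot) := quot_pi (quot_repr a * quot_repr b)%g.
Definition quot_inv (a : quot) := quot_pi (quot_repr a)^-1%g.

Lemma quot_pi_mul x y : quot_mul (quot_pi x) (quot_pi y) = quot_pi (x * y)%g.
Proof.
have sN := openNormal_group N; apply/quot_piP.
have /quot_piP Nx := quot_reprK (quot_pi x).
have /quot_piP Ny := quot_reprK (quot_pi y).
set x' := quot_repr _ in Nx *; set y' := quot_repr _ in Ny *.
have -> : ((x' * y')^-1 * (x * y) =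
           (y'^-1 * y) * (y^-1 * (x'^-1 * x) * y^-1^-1))%g.
  by rewrite invgK invgM !mulgA mulgK.
apply: is_subgroupM => //.
by apply: (@openNormal_normal _ N y^-1%g I); exists (x'^-1 * x)%g.
Qed.

Lemma quot_pi_inv x : quot_inv (quot_pi x) = quot_pi x^-1%g.
Proof.
have sN := openNormal_group N; apply/quot_piP.
have /quot_piP Nx := quot_reprK (quot_pi x).
set x' := quot_repr _ in Nx *; rewrite invgK.
have -> : (x' * x^-1 = x * ((x'^-1 * x)^-1) * x^-1)%g.
  by rewrite invgM invgK mulgA mulgV mul1g.
apply: (@openNormal_normal _ N x I).
by exists (x'^-1 * x)^-1%g => //; apply: is_subgroupV.
Qed.

Lemma quot_mulA : associative quot_mul.
Proof.
move=> a b c; rewrite -[a]quot_reprK -[b]quot_reprK -[c]quot_reprK.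
by rewrite !quot_pi_mul mulgA.
Qed.

Lemma quot_mul1 : left_id (quot_pi 1%g) quot_mul.
Proof. by move=> a; rewrite -[a]quot_reprK quot_pi_mul mul1g. Qed.

Lemma quot_mulV : left_inverse (quot_pi 1%g) quot_inv quot_mul.
Proof. by move=> a; rewrite -[a]quot_reprK quot_pi_inv quot_pi_mul mulVg. Qed.

HB.instance Definition _ :=
  Finite_isGroup.Build quot quot_mulA quot_mul1 quot_mulV.

Lemma quot_piM : {morph quot_pi : x y / (x * y)%g}.
Proof. by move=> x y; rewrite -quot_pi_mul. Qed.

Lemma quot_pi1 : quot_pi 1%g = 1%g.
Proof. by []. Qed.

End Quotient.

Section QuotientMap.
Variables (G : profiniteGroupType) (M N : openNormal G).

(* G/M -> G/N; the canonical projection when M `<=` N *)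
Definition quot_map (q : quot M) : quot N := quot_pi N (quot_repr q).

Hypothesis sMN : M `<=` N.

Lemma quot_map_pi x : quot_map (quot_pi M x) = quot_pi N x.
Proof. by apply/quot_piP/sMN/quot_piP; rewrite quot_reprK. Qed.

Lemma quot_mapM : {morph quot_map : a b / (a * b)%g}.
Proof.
move=> a b; rewrite -[a]quot_reprK -[b]quot_reprK.
by rewrite -quot_piM !quot_map_pi quot_piM.
Qed.

End QuotientMap.
Arguments quot_map {G} M N q.

Definition galg (k : fieldType) (gT : finGroupType) : Type := {ffun gT -> k^o}.

Section GroupAlgebra.
Variables (k : fieldType) (gT : finGroupType).
Local Notation A := (galg k gT).
Implicit Types (a b c : A) (g h : gT).

HB.instance Definition _ := GRing.Lmodule.copy A {ffun gT -> k^o}.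

Definition galg_coef a g : k := (a : {ffun gT -> k^o}) g.
Definition galg_of (f : gT -> k) : A := [ffun g => f g].

Lemma galg_ofE f g : galg_coef (galg_of f) g = f g.
Proof. exact: ffunE. Qed.

Lemma galgP a b : galg_coef a =1 galg_coef b -> a = b.
Proof. by move=> eq_ab; apply/ffunP. Qed.

Lemma galg_coef0 g : galg_coef 0 g = 0. Proof. exact: ffunE. Qed.
Lemma galg_coefD a b g : galg_coef (a + b) g = galg_coef a g + galg_coef b g.
Proof. exact: ffunE. Qed.
Lemma galg_coefN a g : galg_coef (- a) g = - galg_coef a g.
Proof. exact: ffunE. Qed.
Lemma galg_coefZ (x : k) a g : galg_coef (x *: a) g = x * galg_coef a g.
Proof. exact: ffunE. Qed.

Definition galg_elt g : A := galg_of (fun h => (h == g)%:R).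

Definition galg_mul a b : A :=
  galg_of (fun g => \sum_(h : gT) galg_coef a h * galg_coef b (h^-1 * g)%g).

Lemma galg_mulA : associative galg_mul.
Proof.
move=> a b c; apply: galgP => g; rewrite !galg_ofE.
under eq_bigr do rewrite galg_ofE big_distrr /=.
under [RHS]eq_bigr do rewrite galg_ofE big_distrl /=.
rewrite [RHS]exchange_big /=; apply: eq_bigr => h _.
rewrite [RHS](reindex_inj (mulgI h)) /=; apply: eq_bigr => h' _.
by rewrite mulrA mulKg invgM mulgA.
Qed.

Lemma galg_mul1l : left_id (galg_elt 1%g) galg_mul.
Proof.
move=> a; apply: galgP => g; rewrite galg_ofE (bigD1 1%g)//= big1.
  by rewrite galg_ofE eqxx invg1 !mul1g addr0 mul1r.
by move=> h /negPf h1; rewrite galg_ofE h1 mul0r.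
Qed.

Lemma galg_mul1r : right_id (galg_elt 1%g) galg_mul.
Proof.
move=> a; apply: galgP => g; rewrite galg_ofE (bigD1 g)//= big1.
  by rewrite galg_ofE mulVg eqxx addr0 mulr1.
move=> h hg; rewrite galg_ofE; case: eqP => [e|_]; last by rewrite mulr0.
by move: hg; rewrite -[g](mulKg h^-1%g) invgK e mulg1 eqxx.
Qed.

Lemma galg_mulDl : left_distributive galg_mul +%R.
Proof.
move=> a b c; apply: galgP => g; rewrite galg_coefD !galg_ofE -big_split /=.
by apply: eq_bigr => h _; rewrite galg_coefD mulrDl.
Qed.

Lemma galg_mulDr : right_distributive galg_mul +%R.
Proof.
move=> a b c; apply: galgP => g; rewrite galg_coefD !galg_ofE -big_split /=.
by apply: eq_bigr => h _; rewrite galg_coefD mulrDr.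
Qed.

Lemma galg_1_neq0 : galg_elt 1%g != 0.
Proof.
apply/eqP => /(congr1 (fun a => galg_coef a 1%g)).
by rewrite galg_ofE galg_coef0 eqxx => /eqP; rewrite oner_eq0.
Qed.

HB.instance Definition _ := GRing.Zmodule_isNzRing.Build A
  galg_mulA galg_mul1l galg_mul1r galg_mulDl galg_mulDr galg_1_neq0.

Lemma galg_scaleAl (x : k) a b : x *: (a * b) = (x *: a) * b.
Proof.
apply: galgP => g; rewrite galg_coefZ !galg_ofE big_distrr /=.
by apply: eq_bigr => h _; rewrite galg_coefZ mulrA.
Qed.
HB.instance Definition _ := GRing.Lmodule_isLalgebra.Build k A galg_scaleAl.

Lemma galg_scaleAr (x : k) a b : x *: (a * b) = a * (x *: b).
Proof.
apply: galgP => g; rewrite galg_coefZ !galg_ofE big_distrr /=.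
by apply: eq_bigr => h _; rewrite galg_coefZ mulrCA.
Qed.
HB.instance Definition _ := GRing.Lalgebra_isAlgebra.Build k A galg_scaleAr.

Lemma galg_eltM : {morph galg_elt : g h / (g * h)%g >-> g * h}.
Proof.
move=> g h; apply: galgP => x; rewrite !galg_ofE (bigD1 g)//= big1.
  by rewrite !galg_ofE eqxx mul1r addr0 -[in LHS](inj_eq (mulgI g^-1%g)) mulKg.
by move=> y /negPf yg; rewrite galg_ofE yg mul0r.
Qed.

End GroupAlgebra.

Section GroupAlgebraMap.
Variables (k : fieldType) (gT rT : finGroupType) (f : gT -> rT).

Definition galg_map (a : galg k gT) : galg k rT :=
  galg_of (fun y => \sum_(x | f x == y) galg_coef a x).

Lemma galg_mapZ (x : k) a : galg_map (x *: a) = x *: galg_map a.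
Proof.
apply: galgP => y; rewrite galg_coefZ !galg_ofE big_distrr /=.
by apply: eq_bigr => z _; rewrite galg_coefZ.
Qed.

Lemma galg_mapD a b : galg_map (a + b) = galg_map a + galg_map b.
Proof.
apply: galgP => y; rewrite galg_coefD !galg_ofE -big_split /=.
by apply: eq_bigr => z _; rewrite galg_coefD.
Qed.

Lemma galg_map0 : galg_map 0 = 0.
Proof. by rewrite -(scale0r 0) galg_mapZ !scale0r. Qed.

Lemma galg_mapN a : galg_map (- a) = - galg_map a.
Proof. by rewrite -!scaleN1r galg_mapZ. Qed.

Lemma galg_map_elt g : galg_map (galg_elt k g) = galg_elt k (f g).
Proof.
apply: galgP => y; rewrite !galg_ofE eq_sym.
under eq_bigr do rewrite galg_ofE.
have [fgy|fgy] := eqVneq (f g) y; last first.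
  rewrite big1// => x fxy; case: eqP => // xg.
  by rewrite -xg fxy in fgy.
rewrite (bigD1 g) ?fgy//= eqxx big1 ?addr0// => x.
by case/andP=> _ /negPf->.
Qed.

Hypothesis fM : {morph f : x y / (x * y)%g}.

Lemma galg_mapM a b : galg_map (a * b) = galg_map a * galg_map b.
Proof.
have f1 : f 1%g = 1%g by apply: (mulgI (f 1%g)); rewrite -fM !mulg1.
have fV x : f x^-1%g = (f x)^-1%g.
  by apply: (mulgI (f x)); rewrite -fM !mulgV.
apply: galgP => y; rewrite !galg_ofE.
under eq_bigr do rewrite galg_ofE.
rewrite exchange_big /= [LHS](partition_big f xpredT)//=.
apply: eq_bigr => h' _; rewrite !galg_ofE big_distrl /=.
apply: eq_bigr => h /eqP fh; rewrite -big_distrr /=; congr (_ * _).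
rewrite (reindex_inj (mulgI h)) /=; apply: eq_big => [z|z _].
  by rewrite fM fh -(inj_eq (mulgI h'^-1%g)) mulKg.
by rewrite mulKg.
Qed.

End GroupAlgebraMap.

Section CompletedGroupAlgebra.
Variables (k : fieldType) (G : profiniteGroupType).

Definition compatible (x : forall N : openNormal G, galg k (quot N)) :=
  forall M N : openNormal G, M `<=` N -> galg_map (quot_map M N) (x M) = x N.

Record cgalg := CGAlg {
  cgalg_proj :> forall N : openNormal G, galg k (quot N);
  cgalg_compatible : compatible cgalg_proj
}.

Implicit Types x y z : cgalg.

Lemma cgalgP x y : (forall N, x N = y N) -> x = y.
Proof.
case: x y => [x cx] [y cy] /= exy.
have {}exy : x = y by apply: functional_extensionality_dep.
by case: y / exy cy => cy; congr CGAlg; apply: Prop_irrelevance.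
Qed.

HB.instance Definition _ := gen_eqMixin cgalg.
HB.instance Definition _ := gen_choiceMixin cgalg.

Fact cgalg_zero_compatible : compatible (fun N => 0).
Proof. by move=> M N _; exact: galg_map0. Qed.
Definition cgalg_zero := CGAlg cgalg_zero_compatible.

Fact cgalg_add_compatible x y : compatible (fun N => x N + y N).
Proof. by move=> M N sMN; rewrite galg_mapD !cgalg_compatible. Qed.
Definition cgalg_add x y := CGAlg (cgalg_add_compatible x y).

Fact cgalg_opp_compatible x : compatible (fun N => - x N).
Proof. by move=> M N sMN; rewrite galg_mapN !cgalg_compatible. Qed.
Definition cgalg_opp x := CGAlg (cgalg_opp_compatible x).

Fact cgalg_scale_compatible (a : k) x : compatible (fun N => a *: x N).
Proof. by move=> M N sMN; rewrite galg_mapZ !cgalg_compatible. Qed.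
Definition cgalg_scale a x := CGAlg (cgalg_scale_compatible a x).

Fact cgalg_mul_compatible x y : compatible (fun N => x N * y N).
Proof.
move=> M N sMN; rewrite galg_mapM; last exact: quot_mapM.
by rewrite !cgalg_compatible.
Qed.
Definition cgalg_mul x y := CGAlg (cgalg_mul_compatible x y).

Fact cgalg_elt_compatible (g : G) :
  compatible (fun N => galg_elt k (quot_pi N g)).
Proof. by move=> M N sMN; rewrite galg_map_elt quot_map_pi. Qed.

Definition cgalg_elt (g : G) : cgalg := CGAlg (cgalg_elt_compatible g).

Fact cgalg_addA : associative cgalg_add.
Proof. by move=> x y z; apply: cgalgP => N; exact: addrA. Qed.
Fact cgalg_addC : commutative cgalg_add.
Proof. by move=> x y; apply: cgalgP => N; exact: addrC. Qed.
Fact cgalg_add0 : left_id cgalg_zero cgalg_add.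
Proof. by move=> x; apply: cgalgP => N; exact: add0r. Qed.
Fact cgalg_addN : left_inverse cgalg_zero cgalg_opp cgalg_add.
Proof. by move=> x; apply: cgalgP => N; exact: addNr. Qed.
HB.instance Definition _ := GRing.isZmodule.Build cgalg
  cgalg_addA cgalg_addC cgalg_add0 cgalg_addN.

Fact cgalg_mulA : associative cgalg_mul.
Proof. by move=> x y z; apply: cgalgP => N; exact: mulrA. Qed.
Fact cgalg_mul1l : left_id (cgalg_elt 1%g) cgalg_mul.
Proof. by move=> x; apply: cgalgP => N; exact: mul1r. Qed.
Fact cgalg_mul1r : right_id (cgalg_elt 1%g) cgalg_mul.
Proof. by move=> x; apply: cgalgP => N; exact: mulr1. Qed.
Fact cgalg_mulDl : left_distributive cgalg_mul +%R.
Proof. by move=> x y z; apply: cgalgP => N; exact: mulrDl. Qed.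
Fact cgalg_mulDr : right_distributive cgalg_mul +%R.
Proof. by move=> x y z; apply: cgalgP => N; exact: mulrDr. Qed.

Fact setT_subgroup : is_subgroup [set: G].
Proof. by split=> [|x y]; rewrite !inE. Qed.
Fact setT_normal : is_normal_in [set: G] [set: G].
Proof. by []. Qed.
Definition setT_openNormal : openNormal G :=
  OpenNormal setT_subgroup openT setT_normal.

Fact cgalg_1_neq0 : cgalg_elt 1%g != 0.
Proof.
apply/eqP => /(congr1 (fun x : cgalg => x setT_openNormal)) /eqP.
by rewrite (negPf (galg_1_neq0 _ _)).
Qed.
HB.instance Definition _ := GRing.Zmodule_isNzRing.Build cgalg
  cgalg_mulA cgalg_mul1l cgalg_mul1r cgalg_mulDl cgalg_mulDr cgalg_1_neq0.

Fact cgalg_scaleA a b x :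
  cgalg_scale a (cgalg_scale b x) = cgalg_scale (a * b) x.
Proof. by apply: cgalgP => N; exact: scalerA. Qed.
Fact cgalg_scale1 : left_id 1 cgalg_scale.
Proof. by move=> x; apply: cgalgP => N; exact: scale1r. Qed.
Fact cgalg_scaleDr : right_distributive cgalg_scale +%R.
Proof. by move=> a x y; apply: cgalgP => N; exact: scalerDr. Qed.
Fact cgalg_scaleDl x : {morph cgalg_scale^~ x : a b / a + b}.
Proof. by move=> a b; apply: cgalgP => N; exact: scalerDl. Qed.
HB.instance Definition _ := GRing.Zmodule_isLmodule.Build k cgalg
  cgalg_scaleA cgalg_scale1 cgalg_scaleDr cgalg_scaleDl.

Fact cgalg_scaleAl (a : k) x y : a *: (x * y) = (a *: x) * y.
Proof. by apply: cgalgP => N; exact: scalerAl. Qed.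
HB.instance Definition _ := GRing.Lmodule_isLalgebra.Build k cgalg cgalg_scaleAl.
Fact cgalg_scaleAr (a : k) x y : a *: (x * y) = x * (a *: y).
Proof. by apply: cgalgP => N; exact: scalerAr. Qed.
HB.instance Definition _ := GRing.Lalgebra_isAlgebra.Build k cgalg cgalg_scaleAr.

End CompletedGroupAlgebra.

Section Blocks.
Variables (k : fieldType) (G : profiniteGroupType).
Local Notation A := (cgalg k G).
Implicit Types (e f x : A) (E B : set A).

Definition central_idempotent e := (forall x, e * x = x * e) /\ e * e = e.

Definition primitive_central_idempotent e :=
  [/\ central_idempotent e, e != 0 &
      forall f f' : A, central_idempotent f -> central_idempotent f' ->
        f * f' = 0 -> e = f + f' -> f = 0 \/ f' = 0].

Definition block_ideal e : set A := [set x * e | x in [set: A]].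

(* The last clause says that x |-> (x * e)_e is a bijection from k[[G]] onto
   the full product of the k[[G]]e, e in E. *)
Definition block_idempotent_set E :=
  [/\ E `<=` primitive_central_idempotent,
      forall e f, E e -> E f -> e <> f -> e * f = 0 &
      forall y : A -> A, (forall e, E e -> block_ideal e (y e)) ->
        exists! x, forall e, E e -> x * e = y e].

Definition block_idempotent e := exists2 E, block_idempotent_set E & E e.

Definition is_block B := exists2 e, block_idempotent e & B = block_ideal e.

End Blocks.

Section DefectGroups.
Variables (k : fieldType) (G : profiniteGroupType).
Local Notation A := (cgalg k G).
Implicit Types (g : G) (H D : set G) (a e x : A).

Definition cgalg_conj g x : A := cgalg_elt k g * x * cgalg_elt k g^-1%g.

Definition fixed_points H : set A :=
  [set x | forall h, H h -> cgalg_conj h x = x].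

(* Only meaningful when H is an open subgroup (so that G/H is finite) and a is
   fixed by H (so that the choice of coset representatives is immaterial). *)
Definition Tr H a : A :=
  \sum_(C \in left_cosets [set: G] H) cgalg_conj (xget 1%g C) a.

Definition oTr H : set A :=
  \bigcap_(N in [set: openNormal G])
    (Tr (mulset H N) @` fixed_points (mulset H N)).

Definition closed_subgroup H := is_subgroup H /\ closed H.

Definition has_defect_property e D := closed_subgroup D /\ oTr D e.

Definition is_defect_group_idem e D :=
  has_defect_property e D /\
  forall D', has_defect_property e D' -> D' `<=` D -> D' = D.

Definition defect_groups (B : set A) : set (set G) :=
  [set D | exists e, [/\ block_idempotent e, B = block_ideal e &
                         is_defect_group_idem e D]].

End DefectGroups.

(* D/U is a finite p-group for every open normal subgroup U of D; here D has
   the subspace topology, whence U = D `&` O. *)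
Definition pro_p_subgroup (p : nat) (G : profiniteGroupType) (D : set G) :=
  closed_subgroup D /\
  forall U : set G, is_subgroup U -> U `<=` D -> is_normal_in D U ->
    (exists2 O : set G, open O & U = D `&` O) ->
    exists n : nat, (left_cosets D U #= `I_(p ^ n)%N)%card.

Definition conjugacy_class (G : groupType) (D : set G) : set (set G) :=
  [set conjset g D | g in [set: G]].

(* Main.v *)
Require Import Defs.
From mathcomp Require Import all_boot all_order all_algebra fingroup.
From mathcomp Require Import pgroup sylow.
From mathcomp Require Import boolp classical_sets functions cardinality fsbigop.
From mathcomp Require Import topology.

(* Write A = k[[G]] and let e be the block idempotent of B. A closed subgroup D
   satisfies e \in oTr_D^G(A^D) iff e is a trace Tr_H^G(a), a in A^H, for every open
   H containing D. An element of Z(A) is either invertible on e or nilpotent on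
   the image of e in every k[G/N]: the Drazin inverses of its images in the
   finite-dimensional algebras k[G/N] are unique, hence compatible, and so yield an
   idempotent of Z(A), which primitivity of e forces to be trivial on e. The
   second kind being closed under sums, Rosenberg's argument applies: if e is a trace
   from the open subgroups H and K, then e = e * e is a sum of traces from the
   H :&: gKg^-1, hence a trace from one of them. By compactness, any two closed D, D'
   with the defect property have a D :&: gD'g^-1 with that property, whence
   conjugacy of the minimal ones, which exist by Zorn's lemma. The preimage L of a Sylow
   p-subgroup of G/N has the defect property too, its index being invertible in k;
   so a minimal D lies in a conjugate of L, and its image in G/N is a p-group. *)

Set Implicit Arguments.
Unset Strict Implicit.
Unset Printing Implicit Defensive.

Import GRing.Theory.

Local Open Scope classical_set_scope.
Local Open Scope ring_scope.


(** * Compactness and open normal subgroups *)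

Section Compactness.
Variable T : topologicalType.
Hypothesis cT : compact [set: T].

(** If no [F i] lay in [O], the sets [F i] minus [O] would generate a proper filter of closed sets;
    by compactness it has a cluster point, which lies in every [F i] but not in [O]. *)
Lemma compact_directed (I : Type) (i0 : I) (F : I -> set T) (O : set T) :
    (forall i j, exists k, F k `<=` F i `&` F j) ->
    (forall i, closed (F i)) -> open O -> \bigcap_i F i `<=` O ->
  exists i, F i `<=` O.
Proof.
move=> dirF clF oO FO; apply: contrapT => nFO.
pose B i := F i `\` O.
have filB : Filter (filter_from [set: I] B).
  apply: filter_fromT_filter; first by exists i0.
  move=> i j; have [k Fk] := dirF i j; exists k => x [/Fk[Fi Fj] nOx].
  by split; split.
have pB : ProperFilter (filter_from [set: I] B).
  apply: filter_from_proper => i _; apply/set0P/eqP => Bi0.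
  by apply: nFO; exists i; rewrite -setD_eq0.
have [|x [_ xcl]] := cT pB; first by exists i0.
have xB i : B i x.
  have clB : closed (B i) by apply: closedI; [exact: clF|exact: open_closedC].
  by apply: clB => U Ux; apply: xcl => //; exists i.
by have [_] := xB i0; apply; apply: FO => i _; have [] := xB i.
Qed.

Lemma compact_directed_meet (I : Type) (i0 : I) (F : I -> set T) :
    (forall i j, exists k, F k `<=` F i `&` F j) ->
    (forall i, closed (F i)) -> (forall i, F i !=set0) ->
  exists x, forall i, F i x.
Proof.
move=> dirF clF F0; apply: contrapT => nF.
have [||i Fi] := @compact_directed I i0 F set0 dirF clF; first exact: open0.
  by move=> x Fx; apply: nF; exists x => i; exact: Fx.
by have [x /Fi] := F0 i.
Qed.

Hypothesis hT : hausdorff_space T.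

(* By normality the two pieces of a disconnection of the quasi-component lie in
   disjoint open sets; by compactness these already cover a clopen nbhd of x. *)
Lemma clopen_component (x : T) :
  \bigcap_(V in [set V : set T | clopen V /\ V x]) V `<=`
    connected_component [set: T] x.
Proof.
set Q := \bigcap_(V in _) V.
have Qx : Q x by move=> V [].
have clQ : closed Q by apply: closed_bigI => V [[]].
(* Connectedness of [Q]: a nonempty [B] that is open and closed relative to [Q] has to be all of
   [Q]. *)
apply: connected_component_max => // B [b Bb] [C1 oC1 BC1] [C2 cC2 BC2].
have clB : closed B by rewrite BC2; exact: closedI.
have QB : Q `\` B = Q `&` ~` C1.
  rewrite BC1; apply/seteqP; split=> y [Qy nB]; split=> // C1y; first exact: nB.
  by apply: nB; have [] := C1y.
have clQB : closed (Q `\` B).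
  by rewrite QB; apply: closedI => //; exact: open_closedC.
have BQ : B `<=` Q by rewrite BC1; exact: subIsetl.
(* Normality gives a neighbourhood [U] of [B] whose closure misses the other piece of [Q]. *)
have [|U snU UB] := @compact_normal T hT cT B clB (~` (Q `\` B)).
  apply/set_nbhsP; exists (~` (Q `\` B)); split=> //; first exact: closed_openC.
  by move=> y By [].
have /set_nbhsP[U' [oU' BU' U'U]] := snU.
pose V' := ~` closure U'.
have oV' : open V' by apply: closed_openC; exact: closed_closure.
have QV' : Q `\` B `<=` V'.
  by move=> y QBy clUy; apply: (UB y _ QBy); exact: (closureS U'U).
pose P := fun V : set T => clopen V /\ V x.
pose I := {V : set T | P V}.
have clopI (i j : I) : P (sval i `&` sval j).
  by case: i j => [V [cV Vx]] [W [cW Wx]] /=; split=> //; exact: clopenI.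
have [||||[V [[oV clV] Vx]] /= VUV] := @compact_directed I
    (exist P setT (conj clopenT Logic.I)) (fun i => sval i) (U' `|` V').
- by move=> i j; exists (exist P _ (clopI i j)).
- by move=> [V [[]]].
- exact: openU.
- move=> y Fy.
  have Qy : Q y by move=> V VP; apply: (Fy (exist P V VP)).
  by have [/BU'|nBy] := pselect (B y); [left|right; apply: QV'].
have UV0 y : U' y -> V' y -> False by move=> /subset_closure.
(* Inside [V] the disjoint open sets [U'] and [V'] are complementary, so both traces on [V] are
   clopen. The one containing [x] contains all of [Q]. *)
have VUcl : closed (V `&` U').
  have -> : V `&` U' = V `&` ~` V'.
    apply/seteqP; split=> y [Vy]; first by move=> Uy; split=> //; exact: UV0.
    by have [|//] := VUV _ Vy.
  by apply: closedI => //; exact: open_closedC.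
have VVcl : closed (V `&` V').
  have -> : V `&` V' = V `&` ~` U'.
    apply/seteqP; split=> y [Vy]; first by move=> Uy; split=> // /UV0; exact.
    by have [//|] := VUV _ Vy.
  by apply: closedI => //; exact: open_closedC.
have [Ux|V'x] := VUV _ Vx.
  apply/seteqP; split=> // y Qy; apply: contrapT => nBy.
  have [|_ Uy] := Qy (V `&` U'); first by split=> //; split=> //; exact: openI.
  by apply: (UV0 y) => //; apply: QV'.
have [|_ Vb] := BQ _ Bb (V `&` V').
  by split=> //; split=> //; exact: openI.
by have := UV0 b (BU' _ Bb) Vb.
Qed.

(** Total disconnectedness shrinks the quasi-component of [x] to the point [x]. The clopen
    neighbourhoods of [x] form a directed family, so by compactness one of them already lies in
    [O]. *)
Lemma clopen_nbhs (x : T) (O : set T) :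
    totally_disconnected [set: T] -> open O -> O x ->
  exists V : set T, [/\ clopen V, V x & V `<=` O].
Proof.
move=> tdT oO Ox.
pose P := fun V : set T => clopen V /\ V x.
pose I := {V : set T | P V}.
have clopI (i j : I) : P (sval i `&` sval j).
  by case: i j => [V [cV Vx]] [W [cW Wx]] /=; split=> //; exact: clopenI.
have [||||[V [cV Vx]] /= VO] := @compact_directed I
    (exist P setT (conj clopenT Logic.I)) (fun i => sval i) O.
- by move=> i j; exists (exist P _ (clopI i j)).
- by move=> [V [[]]].
- exact: oO.
- move=> y Fy; have : connected_component [set: T] x y.
    by apply: clopen_component => V VP; apply: (Fy (exist P V VP)).
  by rewrite tdT// => ->.
by exists V.
Qed.

End Compactness.

(** * Subgroups of a profinite group and the basis of open normal subgroups *)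

Section Profinite.
Variable G : profiniteGroupType.
Implicit Types (g h : G) (H K D O : set G) (N M : openNormal G).

Lemma mulgl_continuous g : continuous (fun h => g * h)%g.
Proof.
move=> h; apply: (@continuous_comp _ _ _ (fun z : G => (g, z))
                                 (fun xy : G * G => (xy.1 * xy.2)%g)).
  by apply: cvg_pair => /=; [exact: cvg_cst|exact: cvg_id].
exact: mulg_continuous.
Qed.

Lemma mulgr_continuous g : continuous (fun h => h * g)%g.
Proof.
move=> h; apply: (@continuous_comp _ _ _ (fun z : G => (z, g))
                                 (fun xy : G * G => (xy.1 * xy.2)%g)).
  by apply: cvg_pair => /=; [exact: cvg_id|exact: cvg_cst].
exact: mulg_continuous.
Qed.

Lemma is_subgroupP H :
    H 1%g -> (forall g h, H g -> H h -> H (g * h^-1)%g) -> is_subgroup H.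
Proof.
by move=> H1 HM; split; rewrite ?inE// => g h; rewrite !inE; exact: HM.
Qed.

Lemma mem_left_coset H g x : left_coset H g x <-> H (g^-1 * x)%g.
Proof.
split=> [[h Hh <-]|Hx]; first by rewrite mulKg.
by exists (g^-1 * x)%g => //; rewrite mulKVg.
Qed.

Lemma left_coset_eqP H g h : is_subgroup H ->
  left_coset H g = left_coset H h <-> H (g^-1 * h)%g.
Proof.
move=> sH; split=> [E|Hgh].
  by apply/mem_left_coset; rewrite E mem_left_coset mulVg; exact: is_subgroup1.
apply/seteqP; split=> x; rewrite !mem_left_coset => Hx.
  have -> : (h^-1 * x = (g^-1 * h)^-1 * (g^-1 * x))%g.
    by rewrite invgM invgK mulgA mulgK.
  by apply: is_subgroupM => //; exact: is_subgroupV.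
have -> : (g^-1 * x = (g^-1 * h) * (h^-1 * x))%g by rewrite mulgA mulgK.
exact: is_subgroupM.
Qed.

(** [Tr] picks coset representatives with [xget]; the pick does lie in its coset, which is
    nonempty. *)
Lemma left_coset_xget K H C : is_subgroup H -> left_cosets K H C ->
  C = left_coset H (xget 1%g C).
Proof.
move=> sH [g _ <-]; apply/left_coset_eqP => //; apply/mem_left_coset.
apply: (@xgetPex _ 1%g (left_coset H g)); exists g.
by rewrite mem_left_coset mulVg; exact: is_subgroup1.
Qed.

Lemma conjsetE g D x : conjset g D x <-> D (g^-1 * x * g)%g.
Proof.
split=> [[h Dh <-]|Dx]; first by rewrite !mulgA mulVg mul1g mulgKV.
by exists (g^-1 * x * g)%g => //; rewrite !mulgA mulgV mul1g mulgK.
Qed.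

Lemma conjsetM g h D : conjset (g * h)%g D = conjset g (conjset h D).
Proof.
by apply/seteqP; split=> x; rewrite !conjsetE invgM !mulgA.
Qed.

Lemma conjset1 D : conjset 1%g D = D.
Proof. by apply/seteqP; split=> x; rewrite conjsetE invg1 mul1g mulg1. Qed.

Lemma conjsetK g : cancel (conjset g) (conjset g^-1%g).
Proof. by move=> D; rewrite -conjsetM mulVg conjset1. Qed.

Lemma conjsetKV g : cancel (conjset g^-1%g) (conjset g).
Proof. by move=> D; rewrite -conjsetM mulgV conjset1. Qed.

Lemma conjsetS g D D' : D `<=` D' -> conjset g D `<=` conjset g D'.
Proof. by move=> DD' x; rewrite !conjsetE => /DD'. Qed.

Lemma conjset_subgroup g D : is_subgroup D -> is_subgroup (conjset g D).
Proof.
move=> sD; apply: is_subgroupP.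
  by rewrite conjsetE mulg1 mulVg; exact: is_subgroup1.
move=> x y; rewrite !conjsetE => Dx Dy.
suff -> : (g^-1 * (x * y^-1) * g = (g^-1 * x * g) * (g^-1 * y * g)^-1)%g.
  by apply: is_subgroupM => //; exact: is_subgroupV.
by rewrite !invgM invgK !mulgA mulgK.
Qed.

Lemma conjset_closed g D : closed D -> closed (conjset g D).
Proof.
move=> clD; have -> : conjset g D = (fun x => g^-1 * x * g)%g @^-1` D.
  by apply/seteqP; split=> x; rewrite conjsetE.
apply: closed_comp clD => x _.
apply: (@continuous_comp _ _ _ (fun x => g^-1 * x)%g (fun x => x * g)%g).
  exact: mulgl_continuous.
exact: mulgr_continuous.
Qed.

Lemma conjset_closed_subgroup g D :
  closed_subgroup D -> closed_subgroup (conjset g D).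
Proof.
by case=> sD cD; split; [exact: conjset_subgroup|exact: conjset_closed].
Qed.

Lemma conjset_openNormal g N : conjset g N = N.
Proof.
apply/seteqP; split; first exact: openNormal_normal.
by rewrite -{1}[openNormal_set N](conjsetKV g); apply: conjsetS;
   exact: openNormal_normal.
Qed.

Lemma open_subgroup_closed H : is_subgroup H -> open H -> closed H.
Proof.
move=> sH oH; rewrite -[H]setCK; apply: open_closedC.
rewrite openE => x nHx; rewrite /interior.
have : nbhs x ((fun y => x^-1 * y)%g @^-1` H).
  apply: open_nbhs_nbhs; split; last by rewrite /= mulVg; exact: is_subgroup1.
  by apply: open_comp oH => y _; exact: mulgl_continuous.
apply: filterS => y /= Hxy Hy; apply: nHx.
have -> : x = (y * (x^-1 * y)^-1)%g by rewrite invgM invgK mulgA mulgV mul1g.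
by apply: is_subgroupM => //; exact: is_subgroupV.
Qed.

Lemma subgroupI H K : is_subgroup H -> is_subgroup K -> is_subgroup (H `&` K).
Proof.
move=> sH sK; apply: is_subgroupP; first by split; exact: is_subgroup1.
by move=> g h [Hg Kg] [Hh Kh]; split; apply: is_subgroupM => //;
   exact: is_subgroupV.
Qed.

Fact openNormalI_subgroup N M : is_subgroup (N `&` M).
Proof. by apply: subgroupI; exact: openNormal_group. Qed.
Fact openNormalI_normal N M : is_normal_in [set: G] (N `&` M).
Proof.
move=> g _ x /conjsetE[Nx Mx].
by split; rewrite -(conjset_openNormal g); apply/conjsetE.
Qed.
Definition openNormalI N M : openNormal G :=
  OpenNormal (openNormalI_subgroup N M)
    (openI (@openNormal_open _ N) (@openNormal_open _ M))
    (@openNormalI_normal N M).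

(* For a clopen neighbourhood V of 1 inside O, the h with x h y in V <-> x y in V
   for all x, y form an open (tube lemma) normal subgroup inside V. *)
Lemma openNormal_basis O : open O -> O 1%g -> exists N, N `<=` O.
Proof.
move=> oO O1.
have [V [[oV clV] V1 VO]] := clopen_nbhs (@profinite_compact G)
  (@profinite_hausdorff G) (@profinite_totally_disconnected G) oO O1.
pose N : set G := [set h | forall x y, V (x * h * y)%g <-> V (x * y)%g].
have sN : is_subgroup N.
  apply: is_subgroupP; first by move=> x y; rewrite mulg1.
  move=> g h Ng Nh x y; rewrite mulgA -[X in X <-> _](Nh (x * g * h^-1)%g y).
  by rewrite mulgKV; exact: Ng.
have nN : is_normal_in [set: G] N.
  move=> g _ h /conjsetE Nh x y.
  have := Nh (x * g)%g (g^-1 * y)%g.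
  by rewrite !mulgA !mulgK.
suff oN : open N.
  exists (OpenNormal sN oN nN) => h /(_ 1%g 1%g).
  by rewrite mul1g !mulg1 => -[_ /(_ V1)/VO].
(* Membership in a clopen set is locally constant. *)
have locV (z : G) : \forall z' \near z, V z' <-> V z.
  have [Vz|nVz] := pselect (V z).
    apply: filterS (open_nbhs_nbhs (conj oV Vz)) => z' Vz'.
    by split.
  apply: filterS (open_nbhs_nbhs (conj (closed_openC clV) nVz)) => z' Vz'.
  by split.
(* The tube argument runs twice: first over [y] for a fixed [x], then over [x]. *)
have /compact_near_coveringP cG := @profinite_compact G.
rewrite openE => h Nh; rewrite /interior /N /=.
have step (x : G) : \forall x' \near x & h' \near h,
    forall y, V (x' * h' * y)%g <-> V (x' * y)%g.
  pose P (q : G * G) y := V (q.1 * q.2 * y)%g <-> V (q.1 * y)%g.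
  suff : \forall q \near (x, h), [set: G] `<=` P q.
    by apply: filterS => q qP y; exact: qP.
  apply: (cG (G * G)%type (nbhs (x, h)) P (nbhs_filter _)) => y _.
  have c1 : (fun t : G * (G * G) => (t.2.1 * t.2.2 * t.1)%g)
      @ (y, (x, h)) --> (x * h * y)%g.
    pose m := fun q : G * G => (q.1 * q.2)%g.
    have c12 : (fun t : G * (G * G) => m t.2) @ (y, (x, h)) --> (x * h)%g.
      apply: (@cvg_comp _ _ _ (fun t : G * (G * G) => t.2) m); first exact: cvg_snd.
      exact: (@mulg_continuous G (x, h)).
    apply: (@cvg_comp _ _ _ (fun t : G * (G * G) => (m t.2, t.1)) m); last first.
      exact: (@mulg_continuous G ((x * h)%g, y)).
    by apply: cvg_pair => //; exact: cvg_fst.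
  have c2 : (fun t : G * (G * G) => (t.2.1 * t.1)%g) @ (y, (x, h)) --> (x * y)%g.
    pose m := fun q : G * G => (q.1 * q.2)%g.
    apply: (@cvg_comp _ _ _ (fun t : G * (G * G) => (t.2.1, t.1)) m); last first.
      exact: (@mulg_continuous G (x, y)).
    apply: cvg_pair; last exact: cvg_fst.
    apply: (@cvg_comp _ _ _ (fun t : G * (G * G) => t.2) fst); first exact: cvg_snd.
    exact: cvg_fst.
  apply: (@filterS2 _ (nbhs (y, (x, h))) (nbhs_filter _) _ _ _ _
            (c1 _ (locV (x * h * y)%g)) (c2 _ (locV (x * y)%g))).
  move=> -[y' [x' h']] /= e1 e2; rewrite /P /=.
  by split; [move/e1/Nh/e2|move/e2/Nh/e1].
pose Q h' x := forall y, V (x * h' * y)%g <-> V (x * y)%g.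
have nQ := cG G (nbhs h) Q (nbhs_filter h) (fun x _ => step x).
by apply: (@filterS _ (nbhs h) (nbhs_filter h) _ _ _ nQ) => h' + x y; apply.
Qed.

Lemma mulset_subgroup D N : is_subgroup D -> is_subgroup (mulset D N).
Proof.
move=> sD; have sN := openNormal_group N; apply: is_subgroupP.
  by exists 1%g; [exact: is_subgroup1|exists 1%g; [exact: is_subgroup1|exact: mulg1]].
move=> _ _ [d Dd [n Nn <-]] [d' Dd' [n' Nn' <-]].
exists (d * d'^-1)%g; first by apply: is_subgroupM => //; exact: is_subgroupV.
exists (d' * (n * n'^-1) * d'^-1)%g; last by rewrite invgM !mulgA mulgKV.
rewrite -(conjset_openNormal d' N); exists (n * n'^-1)%g => //.
by apply: is_subgroupM => //; exact: is_subgroupV.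
Qed.

Lemma sub_mulset D N : D `<=` mulset D N.
Proof.
move=> d Dd; exists d => //; exists 1%g; last exact: mulg1.
by apply: is_subgroup1; exact: openNormal_group.
Qed.

Lemma sub_mulset_openNormal D N : is_subgroup D -> N `<=` mulset D N.
Proof.
move=> sD n Nn; exists 1%g; first exact: is_subgroup1.
by exists n => //; exact: mul1g.
Qed.

Lemma mulset_sub D N H : is_subgroup H -> D `<=` H -> N `<=` H ->
  mulset D N `<=` H.
Proof. by move=> sH DH NH _ [d /DH Hd [n /NH Hn <-]]; exact: is_subgroupM. Qed.

Lemma mulset_mono D N M : N `<=` M -> mulset D N `<=` mulset D M.
Proof. by move=> NM _ [d Dd [n /NM Mn <-]]; exists d => //; exists n. Qed.

Lemma open_of_openNormal_sub H N : is_subgroup H -> N `<=` H -> open H.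
Proof.
move=> sH NH; rewrite openE => x Hx; rewrite /interior.
have : nbhs x ((fun y => x^-1 * y)%g @^-1` N).
  apply: open_nbhs_nbhs; split.
    by apply: open_comp (@openNormal_open _ N) => y _; exact: mulgl_continuous.
  by rewrite /= mulVg; apply: is_subgroup1; exact: openNormal_group.
apply: filterS => y /= /NH Hxy.
by rewrite -(mulKVg x y); exact: is_subgroupM.
Qed.

Lemma mulset_open D N : is_subgroup D -> open (mulset D N).
Proof.
move=> sD; apply: (@open_of_openNormal_sub _ N).
  exact: mulset_subgroup.
exact: sub_mulset_openNormal.
Qed.

(** If [x] is outside the closed set [D], some [xN] misses [D]; but [x = d * n] would put [d] in
    [xN]. *)
Lemma bigcap_mulset D : is_subgroup D -> closed D ->
  \bigcap_(N in [set: openNormal G]) mulset D N `<=` D.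
Proof.
move=> sD clD x Dx; apply: contrapT => nDx.
have [||N NO] := @openNormal_basis ((fun h => x * h)%g @^-1` (~` D)).
- apply: open_comp; first by move=> y _; exact: mulgl_continuous.
  exact: closed_openC.
- by rewrite /= mulg1.
have [d Dd [n Nn dn]] := Dx N Logic.I.
apply: (NO n^-1%g); first exact: is_subgroupV (openNormal_group N) Nn.
by rewrite -dn mulgK.
Qed.

End Profinite.


(** * Drazin inverses of central elements *)

Section Drazin.
Variable R : nzRingType.
Implicit Types x y z : R.

Definition is_central z := forall x, z * x = x * z.

Lemma central0 : is_central 0. Proof. by move=> x; rewrite mul0r mulr0. Qed.
Lemma central1 : is_central 1. Proof. by move=> x; rewrite mul1r mulr1. Qed.
Lemma centralN y : is_central y -> is_central (- y).
Proof. by move=> cy x; rewrite mulNr mulrN cy. Qed.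
Lemma centralD y z : is_central y -> is_central z -> is_central (y + z).
Proof. by move=> cy cz x; rewrite mulrDl mulrDr cy cz. Qed.
Lemma centralM y z : is_central y -> is_central z -> is_central (y * z).
Proof. by move=> cy cz x; rewrite mulrA -cy -!mulrA cz. Qed.
Lemma centralX n z : is_central z -> is_central (z ^+ n).
Proof.
move=> cz; elim: n => [|n IH]; first by rewrite expr0; exact: central1.
by rewrite exprS; exact: centralM.
Qed.

(** The defining equations of the Drazin inverse; that [y] commutes with [z] comes from [z] being
    central wherever this is used. *)
Definition drazin z y := y * (y * z) = y /\ exists n, z ^+ n = z ^+ n.+1 * y.

Lemma drazin_expr n z y : is_central z -> y * (y * z) = y ->
  y ^+ n.+1 * z ^+ n = y.
Proof.
move=> cz yyz; elim: n => [|n IH]; first by rewrite expr1 expr0 mulr1.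
rewrite exprS -mulrA [z ^+ n.+1]exprSr (mulrA _ _ z) IH.
exact: yyz.
Qed.

(** Substituting the power relation of one inverse into [drazin_expr] for the other gives
    [y = y * z * y'] and [y' = y' * z * y], and the two right-hand sides agree by centrality. *)
Lemma drazin_unique z y y' : is_central z -> is_central y' ->
  drazin z y -> drazin z y' -> y = y'.
Proof.
move=> cz cy' [yyz [n zn]] [yyz' [m zm]].
have Ey : y = y * z * y'.
  rewrite -[LHS](drazin_expr m cz yyz) zm [z ^+ m.+1]exprSr !mulrA.
  by rewrite drazin_expr.
have Ey' : y' = y' * z * y.
  rewrite -[LHS](drazin_expr n cz yyz') zn [z ^+ n.+1]exprSr !mulrA.
  by rewrite drazin_expr.
by rewrite Ey [RHS]Ey' -[RHS]mulrA cz cy'.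
Qed.

Lemma drazin_of_dep n z w : is_central z -> is_central w ->
  z ^+ n = z ^+ n.+1 * w -> drazin z (z ^+ n * w ^+ n.+1).
Proof.
move=> cz cw znw.
(* Iterating the hypothesis trades any number of factors [w] against factors [z]. *)
have E j : z ^+ n = z ^+ (n + j) * w ^+ j.
  elim: j => [|j IH]; first by rewrite addn0 expr0 mulr1.
  rewrite [LHS]IH addnC exprD {1}znw mulrA -exprD -mulrA -exprS.
  by rewrite addnS addnC addnS.
have F : z ^+ n.+1 * (z ^+ n * w ^+ n.+1) = z ^+ n.
  by rewrite mulrA -exprD addnC -E.
split; last by exists n; rewrite F.
rewrite -[X in _ * X]cz [X in _ * X]mulrA -exprS.
rewrite mulrA -[X in X * _]mulrA (centralX n.+1 cw).
by rewrite mulrA -exprD -mulrA mulrA -E.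
Qed.

(** Commuting nilpotents have a nilpotent sum, so on the ideal of [e] they cannot add up to the
    identity unless [e] vanishes. *)
Lemma central_nil_sum_id (e t t' : R) n m :
    is_central t -> is_central t' -> e * e = e -> t * e + t' * e = e ->
    t ^+ n * e = 0 -> t' ^+ m * e = 0 -> e = 0.
Proof.
move=> ct ct' ee te tn t'm.
(* Replacing [e] by any [x] with [e * x = x] lets the induction on the exponent of [t] apply to
   [t * x]. Once [t * x = 0], [t'] fixes [x] and its nilpotency kills [x]. *)
suff nil0 j x : e * x = x -> t ^+ j * x = 0 -> t' ^+ m * x = 0 -> x = 0.
  exact: (nil0 n).
elim: j x => [|j IH] x ex; first by rewrite expr0 mul1r.
move=> tx t'x.
have tx0 : t * x = 0.
  apply: IH; first by rewrite mulrA -ct -mulrA ex.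
    by rewrite mulrA -exprSr.
  by rewrite mulrA -ct -mulrA t'x mulr0.
have t'x1 : t' * x = x.
  by rewrite -{2}ex -te mulrDl -!mulrA ex tx0 add0r.
by rewrite -t'x; elim: (m) => [|i IHi]; rewrite ?expr0 ?mul1r// exprSr -mulrA t'x1.
Qed.

End Drazin.

(** * Central elements of finite group algebras *)

Section GroupAlgebraDrazin.
Variables (k : fieldType) (gT : finGroupType).
Local Notation A := (galg k gT).
Implicit Types (a x z w : A).

Lemma galg_sum_elt a : a = \sum_g galg_coef a g *: galg_elt k g.
Proof.
apply: galgP => h.
have coef_sum (I : finType) (F : I -> A) :
    galg_coef (\sum_i F i) h = \sum_i galg_coef (F i) h.
  by apply: (big_morph (fun x : A => galg_coef x h)) => [x y|];
     [exact: galg_coefD|exact: galg_coef0].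
rewrite coef_sum (bigD1 h)//= galg_coefZ galg_ofE eqxx mulr1 big1 ?addr0//.
by move=> g /negPf gh; rewrite galg_coefZ galg_ofE eq_sym gh mulr0.
Qed.

Lemma galg_centralP z :
  (forall g, z * galg_elt k g = galg_elt k g * z) -> is_central z.
Proof.
move=> cz x; rewrite [x]galg_sum_elt mulr_sumr mulr_suml; apply: eq_bigr => g _.
by rewrite -scalerAr cz scalerAl.
Qed.

(** The first [#|gT| + 1] powers live in a space of dimension [#|gT|]: their coefficient matrix has
    more rows than columns, hence a nonzero left kernel. *)
Lemma galg_powers_dependent z : exists2 v : 'I_#|gT|.+1 -> k,
  (exists i, v i != 0) & \sum_i v i *: z ^+ i = 0.
Proof.
pose M : 'M[k]_(#|gT|.+1, #|gT|) := \matrix_(i, j) galg_coef (z ^+ i) (enum_val j).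
have : kermx M != 0.
  rewrite kermx_eq0 /row_free; apply/negP => /eqP rM.
  by have := rank_leq_col M; rewrite rM ltnn.
case/rowV0Pn => v /sub_kermxP vM v0; exists (v 0).
  by have [i vi] := rV0Pn _ v0; exists i.
apply: galgP => h; rewrite galg_coef0.
have := congr1 (fun B : 'rV[k]_#|gT| => B 0 (enum_rank h)) vM.
rewrite !mxE => <-.
rewrite (big_morph (fun x : A => galg_coef x h)
  (fun x y => galg_coefD x y h) (galg_coef0 k h)).
by apply: eq_bigr => i _; rewrite galg_coefZ mxE enum_rankK.
Qed.

(** In a dependence between powers of [z], let [n] be the least exponent with nonzero coefficient.
    Solving for [z ^+ n] yields [z ^+ n = z ^+ n.+1 * w] with [w] a polynomial in [z], hence
    central. *)
Lemma galg_drazin z : is_central z -> exists2 y, is_central y & drazin z y.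
Proof.
move=> cz; have [v [i0 vi0] vz] := galg_powers_dependent z.
have [n vn nmin] : exists2 n : 'I_#|gT|.+1, v n != 0 &
    forall i : 'I_#|gT|.+1, v i != 0 -> (n <= i)%N.
  case: (@arg_minnP _ i0 (fun i => v i != 0) val vi0) => n vn nmin.
  by exists n.
pose w := - (v n)^-1 *: \sum_(i : 'I_#|gT|.+1 | (n < i)%N) v i *: z ^+ (i - n.+1).
have cZ (c : k) x : is_central x -> is_central (c *: x).
  by move=> cx y; rewrite -scalerAl cx scalerAr.
have cw : is_central w.
  apply: (cZ); apply: (big_ind (@is_central A)).
  - exact: central0.
  - by move=> *; exact: centralD.
  - by move=> i _; apply: cZ; exact: centralX.
have znw : z ^+ n = z ^+ n.+1 * w.
  move: vz; rewrite (bigD1 n)//= => /eqP; rewrite addr_eq0 => /eqP vz.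
  have -> : z ^+ n = (v n)^-1 *: (v n *: z ^+ n).
    by rewrite scalerA mulVf// scale1r.
  rewrite vz -scalerAr scalerN -scaleNr; congr (_ *: _); rewrite mulr_sumr.
  rewrite big_mkcond [RHS]big_mkcond; apply: eq_bigr => i _.
  have [->|ni] := eqVneq i n; first by rewrite ltnn.
  case: ltnP => [lt_ni|le_in]; first by rewrite -scalerAr -exprD subnKC.
  have [->|vi] := eqVneq (v i) 0; first by rewrite scale0r.
  by case/negP: ni; rewrite -val_eqE eqn_leq le_in nmin.
exists (z ^+ n * w ^+ n.+1); last exact: drazin_of_dep.
by apply: centralM; exact: centralX.
Qed.

End GroupAlgebraDrazin.


(** * The centre of a block behaves like a local ring *)

Section Locality.
Variables (k : fieldType) (G : profiniteGroupType).
Local Notation A := (cgalg k G).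
Implicit Types (e x y z : A) (g h : G) (N M : openNormal G).

Lemma cgalg_eltM g h : cgalg_elt k (g * h)%g = cgalg_elt k g * cgalg_elt k h.
Proof. by apply: cgalgP => N; rewrite /= quot_piM galg_eltM. Qed.

Lemma cgalg_conj1 x : cgalg_conj 1%g x = x.
Proof. by rewrite /cgalg_conj invg1 -[cgalg_elt k 1%g]/(1 : A) mul1r mulr1. Qed.

Lemma cgalg_conjM g h x : cgalg_conj (g * h)%g x = cgalg_conj g (cgalg_conj h x).
Proof. by rewrite /cgalg_conj invgM !cgalg_eltM !mulrA. Qed.

Lemma cgalg_conj0 g : cgalg_conj g 0 = 0 :> A.
Proof. by rewrite /cgalg_conj mulr0 mul0r. Qed.

Lemma cgalg_conjD g x y : cgalg_conj g (x + y) = cgalg_conj g x + cgalg_conj g y.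
Proof. by rewrite /cgalg_conj mulrDr mulrDl. Qed.

Lemma cgalg_conj_sum g (I : Type) (r : seq I) (P : pred I) (F : I -> A) :
  cgalg_conj g (\sum_(i <- r | P i) F i) = \sum_(i <- r | P i) cgalg_conj g (F i).
Proof. exact: (big_morph _ (cgalg_conjD g) (cgalg_conj0 g)). Qed.

Lemma cgalg_conj_mul g x y : cgalg_conj g (x * y) = cgalg_conj g x * cgalg_conj g y.
Proof.
rewrite /cgalg_conj !mulrA -[_ * _ * cgalg_elt k g]mulrA -cgalg_eltM mulVg.
by rewrite -[cgalg_elt k 1%g]/(1 : A) mulr1.
Qed.

(** Group elements need not span [k[[G]]], but their images span each [k[G/N]], and equality is
    tested there. *)
Lemma cgalg_centralP x : is_central x <-> forall g, cgalg_conj g x = x.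
Proof.
split=> [cx g|xG y].
  rewrite /cgalg_conj -cx -mulrA -cgalg_eltM mulgV.
  by rewrite -[cgalg_elt k 1%g]/(1 : A) mulr1.
have xg g : x * cgalg_elt k g = cgalg_elt k g * x.
  rewrite -{1}(xG g) /cgalg_conj -mulrA -cgalg_eltM mulVg.
  by rewrite -[cgalg_elt k 1%g]/(1 : A) mulr1.
apply: cgalgP => N; apply: galg_centralP => q; rewrite -[q]quot_reprK.
exact: (congr1 (fun z : A => z N) (xg _)).
Qed.

Lemma central_proj N x : is_central x -> is_central (x N).
Proof.
move=> cx; apply: galg_centralP => q; rewrite -[q]quot_reprK.
exact: (congr1 (fun z : A => z N) (cx (cgalg_elt k (quot_repr q)))).
Qed.

Arguments central_proj N {x}.

(** The projections carry Drazin inverses to Drazin inverses, so uniqueness makes the levelwise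
    choices compatible. The exponent may grow with [N], which is why the last clause is stated at
    each level. *)
Lemma cgalg_drazin z : is_central z -> exists y, [/\ is_central y,
  y * (y * z) = y & forall N, exists n, (z N) ^+ n = (z N) ^+ n.+1 * y N].
Proof.
move=> cz.
have ex N : exists y : galg k (quot N), is_central y /\ drazin (z N) y.
  by have [y cy zy] := galg_drazin (central_proj N cz); exists y.
pose y N := projT1 (cid (ex N)).
have cy N : is_central (y N) by rewrite /y; case: cid => ? [].
have zy N : drazin (z N) (y N) by rewrite /y; case: cid => ? [].
have compy : compatible y.
  move=> M N sMN; have fM := quot_mapM sMN.
  apply: (@drazin_unique _ (z N)) => //; first exact: central_proj.
  have fX n (x : galg k (quot M)) :
      galg_map (quot_map M N) (x ^+ n) = galg_map (quot_map M N) x ^+ n.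
    elim: n => [|n IH]; last by rewrite !exprS galg_mapM// IH.
    rewrite !expr0 -[1]/(galg_elt k 1%g) galg_map_elt; congr galg_elt.
    by apply: (mulgI (quot_map M N 1%g)); rewrite -fM !mulg1.
  have [yyz [n zn]] := zy M; rewrite -(cgalg_compatible z sMN); split.
    by rewrite -!galg_mapM// yyz.
  by exists n; rewrite -!fX -galg_mapM// -zn.
exists (CGAlg compy); split.
- by move=> x; apply: cgalgP => N; exact: cy.
- by apply: cgalgP => N; have [] := zy N.
- by move=> N; have [_] := zy N.
Qed.

Definition block_unit e z := exists2 v : A, is_central v & e = v * z * e.

Variable e : A.
Hypothesis pe : primitive_central_idempotent e.

Lemma block_central : is_central e. Proof. by have [[]] := pe. Qed.
Lemma block_idem : e * e = e. Proof. by have [[]] := pe. Qed.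
Lemma block_neq0 : e <> 0. Proof. by have [_ /eqP] := pe. Qed.

(** With [y] the Drazin inverse, [f = y * z] is a central idempotent, and primitivity applied to
    [e = e * f + e * (1 - f)] leaves two cases. *)
Lemma block_unit_or_nil z : is_central z ->
  block_unit e z \/ forall N, exists n, (z N) ^+ n * e N = 0.
Proof.
move=> cz; have [y [cy yyz zy]] := cgalg_drazin cz.
have ce := block_central.
have [f Ef] : exists f, f = y * z by exists (y * z).
have cf : is_central f by rewrite Ef; exact: centralM.
have ff : f * f = f by rewrite {2}Ef mulrA (cf y) Ef yyz.
have cif x : is_central x -> x * x = x -> central_idempotent (e * x).
  move=> cx xx; split; first by apply: centralM.
  by rewrite mulrA -[e * x * e]mulrA cx mulrA block_idem -mulrA xx.
have cf' : is_central (1 - f) by apply: centralD; [exact: central1|exact: centralN].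
have ff' : f * (1 - f) = 0 by rewrite mulrBr mulr1 ff subrr.
have f'f' : (1 - f) * (1 - f) = 1 - f by rewrite mulrBl mul1r ff' subr0.
have [_ _ /(_ _ _ (cif _ cf ff) (cif _ cf' f'f'))] := pe.
case.
- by rewrite -mulrA (mulrA f) (cf e) -mulrA ff' !mulr0.
- by rewrite -mulrDr addrC subrK mulr1.
(* Case [e * f = 0]: at level [N], [z ^+ n = z ^+ n * (z * y)] is annihilated by [e]. *)
- rewrite Ef => ef0; right=> N; have [n zn] := zy N; exists n.
  have efN : e N * (y N * z N) = 0 := congr1 (fun x : A => x N) ef0.
  have cyN := central_proj N cy; have czN := central_proj N cz.
  have ceN := central_proj N ce.
  by rewrite zn exprSr -ceN -(mulrA _ (z N)) (czN (y N)) mulrA ceN -mulrA efN mulr0.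
(* Case [e = e * f]: [y] inverts [z] on [e]. *)
- rewrite mulrBr mulr1 => /eqP; rewrite subr_eq0 => /eqP eef.
  by left; exists y => //; rewrite -Ef -ce.
Qed.

(** After multiplication by [v] the two terms add up to the identity on [e]. If neither were a unit,
    both would be nilpotent on [e N] for every [N], forcing every [e N], and so [e], to be zero. *)
Lemma block_unit_add z z' : is_central z -> is_central z' ->
  block_unit e (z + z') -> block_unit e z \/ block_unit e z'.
Proof.
move=> cz cz' [v cv ev].
have ce := block_central.
have unit_mul x : block_unit e (v * x) -> block_unit e x.
  by case=> w cw ew; exists (w * v); [exact: centralM|rewrite {1}ew !mulrA].
have [|zn] := block_unit_or_nil (centralM cv cz); first by move=> /unit_mul ?; left.
have [|z'n] := block_unit_or_nil (centralM cv cz'); first by move=> /unit_mul ?; right.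
exfalso; apply: block_neq0; apply: cgalgP => N.
have [n tn] := zn N; have [m t'm] := z'n N.
set t := (v * z) N in tn; set t' := (v * z') N in t'm.
have ct : is_central t by apply: central_proj; exact: centralM.
have ct' : is_central t' by apply: central_proj; exact: centralM.
have te : t * e N + t' * e N = e N.
  rewrite -mulrDl; have := congr1 (fun x : A => x N) ev.
  by rewrite -[(v * (z + z') * e) N]/(v N * (z N + z' N) * e N) mulrDr => <-.
exact: (central_nil_sum_id ct ct' (congr1 (fun x : A => x N) block_idem) te tn t'm).
Qed.

Lemma block_unit_sum (I : finType) (P : pred I) (F : I -> A) :
    (forall i, P i -> is_central (F i)) -> block_unit e (\sum_(i | P i) F i) ->
  exists2 i, P i & block_unit e (F i).
Proof.
move=> cF; apply: contraPP => nF.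
suff [] : is_central (\sum_(i | P i) F i) /\ ~ block_unit e (\sum_(i | P i) F i) by [].
apply: (big_ind (fun z => is_central z /\ ~ block_unit e z)).
- split; first exact: central0.
  by case=> v _; rewrite mulr0 mul0r; exact: block_neq0.
- move=> x y [cx nx] [cy ny]; split; first exact: centralD.
  by move=> /(block_unit_add cx cy)[].
- by move=> i Pi; split; [exact: cF|move=> ui; apply: nF; exists i].
Qed.

End Locality.


(** * Relative traces as orbit sums *)

Section GSets.
Variable G : profiniteGroupType.
Implicit Types (g h : G).

(** Open subgroups enter as stabilizers of points in finite [G]-sets, which turns traces into sums
    over orbits and spares the choice of coset representatives. *)
Definition is_gaction (T : Type) (act : G -> T -> T) :=
  (forall x, act 1%g x = x) /\ forall g h x, act (g * h)%g x = act g (act h x).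

Definition gstab (T : Type) (act : G -> T -> T) x : set G :=
  [set g | act g x = x].

Definition gorb (T : finType) (act : G -> T -> T) x : {set T} :=
  [set y | `[< exists g, y = act g x >]]%SET.

Section Action.
Variables (T : finType) (act : G -> T -> T).
Hypothesis actP : is_gaction act.

Lemma gorbP x y : reflect (exists g, y = act g x) (y \in gorb act x).
Proof. by rewrite inE; exact: asboolP. Qed.

Lemma gactK g : cancel (act g) (act g^-1%g).
Proof. by case: actP => a1 aM x; rewrite -aM mulVg a1. Qed.

Lemma gactVK g : cancel (act g^-1%g) (act g).
Proof. by case: actP => a1 aM x; rewrite -aM mulgV a1. Qed.

Lemma gactI g : injective (act g). Proof. exact: can_inj (gactK g). Qed.

Lemma gorb_refl x : x \in gorb act x.
Proof. by apply/gorbP; exists 1%g; case: actP. Qed.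

Lemma gorb_act g x y : (act g y \in gorb act x) = (y \in gorb act x).
Proof.
case: actP => a1 aM; apply/gorbP/gorbP => -[h E].
  by exists (g^-1 * h)%g; rewrite aM -E gactK.
by exists (g * h)%g; rewrite aM E.
Qed.

Lemma gorb_eq x y : y \in gorb act x -> gorb act y = gorb act x.
Proof.
case: actP => a1 aM /gorbP[g ->]; apply/setP => z; apply/gorbP/gorbP => -[h ->].
  by exists (h * g)%g; rewrite aM.
by exists (h * g^-1)%g; rewrite aM gactK.
Qed.

Lemma gorb_actx g x : gorb act (act g x) = gorb act x.
Proof. by apply: gorb_eq; apply/gorbP; exists g. Qed.

Lemma gstab_act g x : gstab act (act g x) = conjset g (gstab act x).
Proof.
case: actP => a1 aM; apply/seteqP; split=> h; rewrite conjsetE /gstab /= !aM.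
  by move=> ->; rewrite gactK.
by move=> E; rewrite -{2}E gactVK.
Qed.

Lemma gstab_subgroup x : is_subgroup (gstab act x).
Proof.
case: actP => a1 aM; apply: is_subgroupP; first exact: a1.
by move=> g h gx hx; rewrite /gstab /= aM -[in LHS]hx gactK.
Qed.

Lemma gstab_eq g h x : gstab act x (g^-1 * h)%g <-> act g x = act h x.
Proof.
case: actP => _ aM; rewrite /gstab /= aM; split=> [E|<-]; last exact: gactK.
by rewrite -{1}E gactVK.
Qed.

End Action.

(** The inclusion of stabilizers is what makes sending [act g x] to [act' g x'] well defined. *)
Lemma gorb_map (T T' : finType) (act : G -> T -> T) (act' : G -> T' -> T') x x' :
    is_gaction act -> is_gaction act' -> gstab act x `<=` gstab act' x' ->
  exists f : T -> T', forall g, f (act g x) = act' g x'.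
Proof.
move=> aP aP' sxx'.
(* Off the orbit of [x] the default [1%g] is picked and the value is [x']. *)
exists (fun z => act' (xget 1%g [set g | z = act g x]) x') => g.
set g' := xget _ _.
have gg' : act g x = act g' x.
  exact: (@xgetPex _ 1%g [set h | act g x = act h x] (ex_intro _ g erefl)).
by apply/esym/(gstab_eq aP'); apply: sxx'; apply/(gstab_eq aP).
Qed.

Section Traces.
Variable k : fieldType.
Local Notation A := (cgalg k G).

Definition equivariant (T : Type) (act : G -> T -> T) (F : T -> A) :=
  forall g x, F (act g x) = cgalg_conj g (F x).

(** Orbit-stabilizer: a coset of the stabilizer corresponds to the point to which it moves [x], and
    equivariance turns the conjugates of [F x] into the values of [F]. *)
Lemma Tr_gstab (T : finType) (act : G -> T -> T) (F : T -> A) x :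
    is_gaction act -> equivariant act F ->
  Tr (gstab act x) (F x) = \sum_(y in gorb act x) F y.
Proof.
move=> aP eF; have sx := gstab_subgroup aP x.
rewrite -big_enum fsbig_seq ?enum_uniq//= /Tr.
rewrite (reindex_fsbig (fun C => act (xget 1%g C) x)
           (left_cosets [set: G] (gstab act x))); last first.
  split.
  - by move=> C _ /=; rewrite mem_enum; apply/gorbP; exists (xget 1%g C).
  - move=> C C' /set_mem/(left_coset_xget sx) EC /set_mem/(left_coset_xget sx) EC'.
    by move=> /(gstab_eq aP) E; rewrite EC EC'; apply/left_coset_eqP => //; exact: E.
  - move=> y /=; rewrite mem_enum => /gorbP[g ->].
    have gC : left_cosets [set: G] (gstab act x) (left_coset (gstab act x) g).
      by exists g.
    exists (left_coset (gstab act x) g) => //; apply/(gstab_eq aP).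
    by apply/left_coset_eqP => //; rewrite -(left_coset_xget sx gC).
by apply: eq_fsbigr => C _; rewrite eF.
Qed.

(** Transporting [a] along the orbit is unambiguous because the stabilizer fixes [a]; off the orbit
    the function is zero. *)
Lemma equivariant_ext (T : finType) (act : G -> T -> T) x (a : A) :
    is_gaction act -> fixed_points (gstab act x) a ->
  exists2 F : T -> A, equivariant act F & F x = a.
Proof.
move=> aP fa; have [a1 aM] := aP.
pose r z := xget 1%g [set g | z = act g x].
have rP z : z \in gorb act x -> z = act (r z) x.
  move=> /gorbP[g zg].
  exact: (@xgetPex _ 1%g [set h | z = act h x] (ex_intro _ g zg)).
exists (fun z => if z \in gorb act x then cgalg_conj (r z) a else 0); last first.
  by rewrite gorb_refl// fa// /gstab /= -rP ?gorb_refl.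
move=> g z; rewrite gorb_act//; case: ifP => zx; last by rewrite cgalg_conj0.
(* The elements [g * r z] and [r (act g z)] both carry [x] to [act g z], so they differ by an
   element of the stabilizer. *)
rewrite -cgalg_conjM -[in RHS](fa ((g * r z)^-1 * r (act g z))%g).
  by rewrite -cgalg_conjM mulgA mulgV mul1g.
have E : act g z = act (g * r z)%g x by rewrite aM -rP.
by rewrite /gstab /= aM -rP ?gorb_act// E gactK.
Qed.

Variable e : A.

Definition trace_from H := (Tr H @` fixed_points H) e.

Lemma trace_from_gstab (T : finType) (act : G -> T -> T) (F : T -> A) x :
    is_gaction act -> equivariant act F -> \sum_(y in gorb act x) F y = e ->
  trace_from (gstab act x).
Proof.
move=> aP eF Fe; exists (F x); last by rewrite Tr_gstab.
by move=> h hx; rewrite -eF hx.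
Qed.

Lemma trace_from_sum (T : finType) (act : G -> T -> T) x :
    is_gaction act -> trace_from (gstab act x) ->
  exists2 F : T -> A, equivariant act F & \sum_(y in gorb act x) F y = e.
Proof.
move=> aP [a fa <-]; have [F eF Fx] := equivariant_ext aP fa.
by exists F; rewrite // -Fx Tr_gstab.
Qed.

(** Transitivity of the trace: summing [F] over the fibres of the map between the orbits gives an
    equivariant function on the second orbit with the same total. *)
Lemma trace_from_gstabS (T T' : finType) (act : G -> T -> T) (act' : G -> T' -> T')
    x x' :
    is_gaction act -> is_gaction act' -> gstab act x `<=` gstab act' x' ->
  trace_from (gstab act x) -> trace_from (gstab act' x').
Proof.
move=> aP aP' sxx' /(trace_from_sum aP)[F eF Fe].
have [f fP] := gorb_map aP aP' sxx'; have [_ aM] := aP; have [_ aM'] := aP'.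
pose F' y := \sum_(z in gorb act x | f z == y) F z.
apply: (@trace_from_gstab _ act' F') => //; last first.
  rewrite -Fe [in RHS](partition_big f [in gorb act' x'])//.
  by move=> _ /gorbP[g ->]; rewrite fP; apply/gorbP; exists g.
move=> g y; rewrite /F' cgalg_conj_sum.
rewrite (reindex_inj (gactI aP (g := g))); apply: eq_big => [z|z _]; last exact: eF.
rewrite gorb_act//; apply: andb_id2l => /gorbP[h ->].
by rewrite -aM !fP aM' (inj_eq (gactI aP' (g := g))).
Qed.

(** The conjugate stabilizer belongs to another point of the same orbit, and the orbit sum does not
    see the difference. *)
Lemma trace_from_conj (T : finType) (act : G -> T -> T) x g : is_gaction act ->
  trace_from (gstab act x) -> trace_from (conjset g (gstab act x)).
Proof.
move=> aP /(trace_from_sum aP)[F eF Fe].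
rewrite -gstab_act//; apply: (trace_from_gstab aP eF).
by rewrite gorb_actx.
Qed.

Hypothesis pe : primitive_central_idempotent e.

(* The orbit sums of F are central and add up to e, so one of them is invertible
   on e. *)
Lemma trace_from_rosenberg (T : finType) (act : G -> T -> T) (F : T -> A)
    (P : pred T) :
    is_gaction act -> equivariant act F ->
    (forall g x, P (act g x) = P x) -> \sum_(x | P x) F x = e ->
  exists2 x, P x & trace_from (gstab act x).
Proof.
move=> aP eF invP Fe; have [_ aM] := aP.
have ce := block_central pe; have ee := block_idem pe.
(* The index [Q] runs over all subsets of [T]; the sum is empty unless [Q] is an orbit contained in
   [P]. *)
pose Z Q := \sum_(x | P x && (gorb act x == Q)) F x.
have cZ Q : is_central (Z Q).
  apply/cgalg_centralP => g; rewrite /Z cgalg_conj_sum.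
  rewrite [RHS](reindex_inj (gactI aP (g := g))); apply: eq_big => x.
    by rewrite invP gorb_actx.
  by rewrite eF.
have [||Q _ [v cv ev]] := @block_unit_sum k G e pe {set T} xpredT Z.
- by move=> Q _; exact: cZ.
- rewrite /Z -(partition_big (gorb act) xpredT)// Fe.
  by exists 1; [exact: central1|rewrite mul1r].
have [x /andP[Px /eqP xQ]] : exists x, P x && (gorb act x == Q).
  apply: contrapT => nx; case: (block_neq0 pe).
  rewrite ev /Z big_pred0 ?mulr0 ?mul0r// => x.
  by apply/negbTE/negP => xQ; apply: nx; exists x.
exists x => //.
have cve : is_central (v * e) by exact: centralM.
(* Rescaling [F] by the central element [v * e] keeps it equivariant and makes the sum over this
   orbit equal to [v * Z Q * e], which is [e]. *)
apply: (@trace_from_gstab _ act (fun y => v * e * F y)) => //.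
  move=> g y; rewrite eF cgalg_conj_mul.
  by have /cgalg_centralP -> := cve.
rewrite -mulr_sumr [RHS]ev -!mulrA ce !mulrA; congr (_ * _ * _).
apply: eq_bigl => y; apply/idP/andP => [yx|[Py /eqP yQ]]; last first.
  by rewrite xQ -yQ gorb_refl.
split; last by rewrite (gorb_eq aP yx) xQ.
by have /gorbP[g ->] := yx; rewrite invP.
Qed.

(** Mackey's formula without double cosets: [e * e] is the sum of [F z.1 * F' z.2] over the product
    of two orbits, where point stabilizers are intersections of conjugates of the given ones. *)
Lemma trace_from_meet (T T' : finType) (act : G -> T -> T) (act' : G -> T' -> T')
    x x' :
    is_gaction act -> is_gaction act' ->
    trace_from (gstab act x) -> trace_from (gstab act' x') ->
  exists g, trace_from (gstab act x `&` conjset g (gstab act' x')).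
Proof.
move=> aP aP' /(trace_from_sum aP)[F eF Fe] /(trace_from_sum aP')[F' eF' Fe'].
have [a1 aM] := aP; have [a1' aM'] := aP'.
pose act2 g (z : T * T') := (act g z.1, act' g z.2).
have aP2 : is_gaction act2.
  split=> [[y y']|g h [y y']]; rewrite /act2 /= ?a1 ?a1'//.
  by rewrite aM aM'.
pose P (z : T * T') := (z.1 \in gorb act x) && (z.2 \in gorb act' x').
have stab2 z : gstab act2 z = gstab act z.1 `&` gstab act' z.2.
  apply/seteqP; split=> g; rewrite /gstab /act2 /=; first by case: z => y y' [].
  by case: z => y y' /= [-> ->].
have [|||[y y'] /andP[/= /gorbP[g ->] /gorbP[h ->]] tr] :=
    @trace_from_rosenberg _ act2 (fun z => F z.1 * F' z.2) P aP2.
- by move=> g z; rewrite /= eF eF' cgalg_conj_mul.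
- by move=> g z; rewrite /P /= !gorb_act.
- rewrite -[RHS](block_idem pe) -{1}Fe -Fe' big_distrlr /=.
  by rewrite pair_big.
(* Translating the point found by [g^-1] brings its first coordinate back to [x]. *)
exists (g^-1 * h)%g.
have := trace_from_conj g^-1%g aP2 tr; rewrite -gstab_act// stab2 /=.
by rewrite gactK// -aM' gstab_act.
Qed.

End Traces.

(** * Open subgroups as stabilizers in finite sets *)

Section CosetAction.
Variable N : openNormal G.

(** The action is on all subsets of [quot N], so that one finite [G]-set serves every subgroup
    containing [N]; the orbit of the image of such a subgroup is its set of left cosets. *)
Definition coset_act g (C : {set quot N}) := lcoset C (quot_pi N g).
Definition quot_image (H : set G) : {set quot N} :=
  [set q | `[< H (quot_repr q) >]]%SET.

Lemma coset_actP : is_gaction coset_act.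
Proof.
split=> [C|g h C]; first by rewrite /coset_act quot_pi1 !lcosetE mul1g.
by rewrite /coset_act quot_piM !lcosetE lcosetM.
Qed.

Lemma mem_quot_image H g : is_subgroup H -> N `<=` H ->
  (quot_pi N g \in quot_image H) <-> H g.
Proof.
move=> sH NH; rewrite inE; split=> [/asboolP|] Hg.
  have /quot_piP/NH Hr := quot_reprK (quot_pi N g).
  by rewrite -[g](mulKVg (quot_repr (quot_pi N g))); exact: is_subgroupM.
apply/asboolP; have /esym/quot_piP/NH Hr := quot_reprK (quot_pi N g).
by rewrite -[quot_repr _](mulKVg g); exact: is_subgroupM.
Qed.

Lemma gstab_coset_act H : is_subgroup H -> N `<=` H ->
  gstab coset_act (quot_image H) = H.
Proof.
move=> sH NH; apply/seteqP; split=> g; rewrite /gstab /= /coset_act lcosetE.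
  move=> E; apply/(mem_quot_image g sH NH); rewrite -E mem_lcoset.
  by rewrite mulVg -(quot_pi1 N); apply/(mem_quot_image 1%g sH NH); exact: is_subgroup1.
move=> Hg; apply/setP => q; rewrite mem_lcoset -[q]quot_reprK.
set h := quot_repr q.
have -> : ((quot_pi N g)^-1 * quot_pi N h = quot_pi N (g^-1 * h))%g.
  by rewrite quot_piM -quot_pi_inv.
apply/idP/idP => /(mem_quot_image _ sH NH) Hh; apply/(mem_quot_image _ sH NH).
  by rewrite -[h](mulKVg g); exact: is_subgroupM.
by apply: is_subgroupM => //; exact: is_subgroupV.
Qed.

End CosetAction.
End GSets.


(** * Defect groups *)

Section QuotientImage.
Variables (G : profiniteGroupType) (N : openNormal G).
Implicit Types (g : G) (H D U : set G).

Lemma quot_image_group_set H : is_subgroup H -> N `<=` H ->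
  group_set (quot_image N H).
Proof.
move=> sH NH; apply/group_setP; split.
  by rewrite -(quot_pi1 N); apply/(mem_quot_image 1%g sH NH); exact: is_subgroup1.
move=> q r; rewrite -[q]quot_reprK -[r]quot_reprK.
move=> /(mem_quot_image _ sH NH) Hq /(mem_quot_image _ sH NH) Hr.
by rewrite -quot_piM; apply/(mem_quot_image _ sH NH); exact: is_subgroupM.
Qed.

(** The map from [D/U] to the cosets of [UN/N] in [DN/N] is onto because every coset of [N] in [DN]
    meets [D], and injective because [D] meets [UN] only in [U]. *)
Lemma card_left_cosets D U : is_subgroup D -> is_subgroup U -> U `<=` D ->
    D `&` N `<=` U ->
  (left_cosets D U #=
     `I_#|lcosets (quot_image N (mulset U N)) (quot_image N (mulset D N))|)%card.
Proof.
move=> sD sU UD DNU.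
have [sDN sUN] := (mulset_subgroup N sD, mulset_subgroup N sU).
have [NDN NUN] := (@sub_mulset_openNormal _ D N sD,
                   @sub_mulset_openNormal _ U N sU).
set Ub := quot_image N (mulset U N); set Db := quot_image N (mulset D N).
pose Ug := Group (quot_image_group_set sUN NUN).
have UbE g h : (quot_pi N g *: Ub = quot_pi N h *: Ub)%g <-> mulset U N (g^-1 * h)%g.
  have E : ((quot_pi N g)^-1 * quot_pi N h = quot_pi N (g^-1 * h))%g.
    by rewrite quot_piM -quot_pi_inv.
  rewrite -(mem_quot_image _ sUN NUN) -/Ub -E -mem_lcoset.
  split=> [gh|/(@lcoset_eqP _ Ug)->//].
  by rewrite gh; exact: (lcoset_refl Ug).
(* Modular law: an element [u * n] of [D] has [n] in [D] and in [N], hence in [U]. *)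
have UDE g h : D g -> D h -> mulset U N (g^-1 * h)%g -> U (g^-1 * h)%g.
  move=> Dg Dh [u Uu [n Nn un]]; rewrite -un; apply: is_subgroupM => //.
  apply: DNU; split=> //; rewrite -(mulKg u n) un.
  by do 2?[apply: is_subgroupM => //]; apply: is_subgroupV => //; exact: UD.
have Dx C : left_cosets D U C -> D (xget 1%g C).
  move=> CC; have := left_coset_xget sU CC; case: CC => d Dd <- /left_coset_eqP.
  move=> /(_ sU)/UD Ddx; rewrite -(mulKVg d (xget _ _)).
  exact: is_subgroupM.
have memDb d : D d -> (quot_pi N d *: Ub)%g \in lcosets Ub Db.
  move=> Dd; apply/lcosetsP; exists (quot_pi N d) => //.
  by apply/(mem_quot_image _ sDN NDN); exact: sub_mulset.
set L := lcosets Ub Db; pose f C := index (quot_pi N (xget 1%g C) *: Ub)%g (enum L).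
apply/card_set_bijP; exists f; split.
- by move=> C CC /=; rewrite cardE index_mem mem_enum memDb//; exact: Dx.
- move=> C C' /set_mem CC /set_mem CC' fCC'.
  have Dg := Dx _ CC; have Dg' := Dx _ CC'.
  rewrite (left_coset_xget sU CC) (left_coset_xget sU CC'); apply/left_coset_eqP => //.
  apply: UDE => //; apply/UbE.
  rewrite -[LHS](@nth_index _ Ub _ (enum L)); last by rewrite mem_enum memDb.
  by rewrite -/(f C) fCC' nth_index// mem_enum memDb.
- move=> i /=; rewrite cardE => iL.
  have : nth Ub (enum L) i \in L by rewrite -mem_enum mem_nth.
  case/lcosetsP => q /[dup] qDb + E; rewrite -[q]quot_reprK.
  case/(mem_quot_image _ sDN NDN) => d Dd [n Nn dn].
  have qd : q = quot_pi N d.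
    rewrite -[q]quot_reprK -dn; apply/esym/quot_piP.
    by rewrite mulKg.
  have dC : left_cosets D U (left_coset U d) by exists d.
  exists (left_coset U d) => //.
  suff -> : f (left_coset U d) = index (nth Ub (enum L) i) (enum L).
    by rewrite index_uniq// enum_uniq.
  rewrite /f E qd; congr index; apply/esym/UbE.
  apply: sub_mulset; apply/left_coset_eqP => //.
  by rewrite -(left_coset_xget sU dC).
Qed.

End QuotientImage.

(** * The defect property: traces from open overgroups, existence and conjugacy of minimal
    subgroups *)

Section TracesOpen.
Variables (k : fieldType) (G : profiniteGroupType) (e : cgalg k G).
Implicit Types (g h : G) (D H K : set G) (N M : openNormal G).

Lemma open_subgroup_contains H : is_subgroup H -> open H -> exists N, N `<=` H.
Proof. by move=> sH oH; apply: openNormal_basis => //; exact: is_subgroup1. Qed.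

(** An open normal subgroup inside [H] lies in [K] too, so both are stabilizers for the same coset
    action. *)
Lemma trace_fromS H K : is_subgroup H -> is_subgroup K -> open H -> H `<=` K ->
  trace_from e H -> trace_from e K.
Proof.
move=> sH sK oH HK; have [N NH] := open_subgroup_contains sH oH.
have NK := subset_trans NH HK.
rewrite -(gstab_coset_act sH NH) -(gstab_coset_act sK NK).
apply: trace_from_gstabS; rewrite ?gstab_coset_act//; exact: coset_actP.
Qed.

Lemma trace_from_conjset g H : is_subgroup H -> open H ->
  trace_from e H -> trace_from e (conjset g H).
Proof.
move=> sH oH; have [N NH] := open_subgroup_contains sH oH.
rewrite -(gstab_coset_act sH NH); apply: trace_from_conj; exact: coset_actP.
Qed.

Lemma has_defect_propertyP D : has_defect_property e D <->
  closed_subgroup D /\ forall N, trace_from e (mulset D N).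
Proof.
by split=> -[cD tD]; split=> // N; [apply: tD|move=> _; exact: tD].
Qed.

Lemma has_defect_property_open D K : has_defect_property e D ->
  is_subgroup K -> open K -> D `<=` K -> trace_from e K.
Proof.
move=> /has_defect_propertyP[[sD cD] tD] sK oK DK.
have [N NK] := open_subgroup_contains sK oK.
apply: trace_fromS (tD N) => //; first exact: mulset_subgroup.
  exact: mulset_open.
exact: mulset_sub.
Qed.

Lemma open_has_defect_property H : is_subgroup H -> open H ->
  trace_from e H -> has_defect_property e H.
Proof.
move=> sH oH tH; apply/has_defect_propertyP; split.
  by split=> //; exact: open_subgroup_closed.
move=> N; apply: trace_fromS tH => //; first exact: mulset_subgroup.
exact: sub_mulset.
Qed.

Lemma has_defect_property_conj g D :
  has_defect_property e D -> has_defect_property e (conjset g D).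
Proof.
move=> dD; have [[sD cD] _] := dD; apply/has_defect_propertyP.
split; first exact: conjset_closed_subgroup.
(* Conjugating [mulset (conjset g D) N] back by [g^-1] gives an open subgroup containing [D], from
   which [e] is a trace. *)
move=> N; rewrite -[mulset _ _](conjsetKV g); apply: trace_from_conjset.
- by apply: conjset_subgroup; apply: mulset_subgroup; exact: conjset_subgroup.
- apply: (@open_of_openNormal_sub _ _ N).
    by apply: conjset_subgroup; apply: mulset_subgroup; exact: conjset_subgroup.
  rewrite -{1}(conjset_openNormal g^-1%g N); apply: conjsetS.
  by apply: sub_mulset_openNormal; exact: conjset_subgroup.
- apply: (has_defect_property_open dD).
  + by apply: conjset_subgroup; apply: mulset_subgroup; exact: conjset_subgroup.
  + apply: (@open_of_openNormal_sub _ _ N).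
      by apply: conjset_subgroup; apply: mulset_subgroup; exact: conjset_subgroup.
    rewrite -{1}(conjset_openNormal g^-1%g N); apply: conjsetS.
    by apply: sub_mulset_openNormal; exact: conjset_subgroup.
  + rewrite -{1}(conjsetK g D); apply: conjsetS; exact: sub_mulset.
Qed.

(** The lower bound for Zorn's lemma: by compactness, each open subgroup [mulset (\bigcap_i D i) N]
    already contains some [D i]. *)
Lemma has_defect_property_bigcap (I : Type) (i0 : I) (D : I -> set G) :
    (forall i, has_defect_property e (D i)) ->
    (forall i j, exists l, D l `<=` D i `&` D j) ->
  has_defect_property e (\bigcap_i D i).
Proof.
move=> dD dirD.
have sD i : is_subgroup (D i) by have [[]] := dD i.
have sI : is_subgroup (\bigcap_i D i).
  apply: is_subgroupP; first by move=> i _; exact: is_subgroup1.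
  move=> g h Dg Dh i _; apply: is_subgroupM => //; first exact: Dg.
  by apply: is_subgroupV => //; exact: Dh.
apply/has_defect_propertyP; split.
  by split=> //; apply: closed_bigI => i _; have [[]] := dD i.
move=> N; have [|||||i DiN] := @compact_directed G _ I i0 D (mulset (\bigcap_i D i) N).
- exact: profinite_compact.
- exact: dirD.
- by move=> i; have [[]] := dD i.
- exact: mulset_open.
- exact: sub_mulset.
apply: (has_defect_property_open (dD i)) => //; first exact: mulset_subgroup.
exact: mulset_open.
Qed.

Hypothesis pe : primitive_central_idempotent e.

Lemma trace_from_open_meet H K : is_subgroup H -> is_subgroup K -> open H ->
  open K -> trace_from e H -> trace_from e K ->
  exists g, trace_from e (H `&` conjset g K).
Proof.
move=> sH sK oH oK.
have [N NH] := open_subgroup_contains sH oH.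
have [M MK] := open_subgroup_contains sK oK.
rewrite -{1 2}(gstab_coset_act sH NH) -{1 2}(gstab_coset_act sK MK).
by apply: (trace_from_meet pe); exact: coset_actP.
Qed.

(** At each level [N] some [g] works for the open subgroups [mulset D N] and [mulset D' N]. The sets
    [X N] of such [g] are closed and directed, so compactness yields one [g] good for all levels. *)
Lemma has_defect_property_meet D D' :
    has_defect_property e D -> has_defect_property e D' ->
  exists g, has_defect_property e (D `&` conjset g D').
Proof.
move=> /has_defect_propertyP[[sD cD] tD] /has_defect_propertyP[[sD' cD'] tD'].
pose F g N := mulset D N `&` conjset g (mulset D' N).
have sDN N : is_subgroup (mulset D N) by exact: mulset_subgroup.
have sDN' g N : is_subgroup (conjset g (mulset D' N)).
  by apply: conjset_subgroup; exact: mulset_subgroup.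
have sF g N : is_subgroup (F g N) by exact: subgroupI.
have oF g N : open (F g N).
  apply: (@open_of_openNormal_sub _ _ N) => // n Nn.
  split; first exact: sub_mulset_openNormal.
  apply: (conjsetS (@sub_mulset_openNormal _ D' N sD')).
  by rewrite conjset_openNormal.
have FS g N M : N `<=` M -> F g N `<=` F g M.
  by move=> NM; apply: setISS; [|apply: conjsetS]; exact: mulset_mono.
pose X N := [set g | trace_from e (F g N)].
have [||||g Xg] := @compact_directed_meet G _ (openNormal G) (setT_openNormal G) X.
- exact: profinite_compact.
- move=> N M; exists (openNormalI N M) => g tg.
  by split; apply: trace_fromS tg => //; apply: FS => x [].
(* [X N] is a union of left cosets of [N], since elements of [N] normalize [mulset D' N]; its
   complement is therefore open. *)
- move=> N; rewrite -[X N]setCK; apply: open_closedC.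
  rewrite openE => g nXg; rewrite /interior.
  have : nbhs g ((fun h => g^-1 * h)%g @^-1` N).
    apply: open_nbhs_nbhs; split.
      by apply: open_comp (@openNormal_open _ N) => y _; exact: mulgl_continuous.
    by rewrite /= mulVg; apply: is_subgroup1; exact: openNormal_group.
  apply: filterS => h /= Ngh Xh; apply: nXg.
  suff -> : X N g = X N h by [].
  rewrite /X /F /= -(mulKVg g h) conjsetM.
  congr (trace_from e (_ `&` conjset g _)).
  have sN' : is_subgroup (mulset D' N) by exact: mulset_subgroup.
  have D'gh := sub_mulset_openNormal sD' Ngh.
  apply/seteqP; split=> x; rewrite conjsetE => D'x.
    by apply: is_subgroupM => //; apply: is_subgroupM => //; exact: is_subgroupV.
  rewrite -[x](mulKVg (g^-1 * h)%g) -[X in (_ * X)%g](mulgK (g^-1 * h)%g).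
  apply: is_subgroupM => //; apply: is_subgroupM => //; last exact: is_subgroupV.
- by move=> N; apply: trace_from_open_meet => //;
    [exact: mulset_subgroup|exact: mulset_open|exact: mulset_open].
exists g; apply/has_defect_propertyP.
have sI : is_subgroup (D `&` conjset g D').
  by apply: subgroupI => //; exact: conjset_subgroup.
split; first by split=> //; apply: closedI => //; exact: conjset_closed.
(* For this [g] the subgroups [F g M] shrink to [D] meet [conjset g D'], so one of them lies in the
   given open overgroup and the trace passes up. *)
move=> N; have [|||||M FM] := @compact_directed G _ (openNormal G)
    (setT_openNormal G) (F g) (mulset (D `&` conjset g D') N).
- exact: profinite_compact.
- move=> N1 N2; exists (openNormalI N1 N2) => x Fx.
  by split; apply: FS Fx => y [].
- by move=> M; exact: open_subgroup_closed.
- exact: mulset_open.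
- apply: (@subset_trans _ (D `&` conjset g D')); last exact: sub_mulset.
  move=> x Fx; split; first by apply: bigcap_mulset => // M _; have [] := Fx M Logic.I.
  apply/conjsetE; apply: bigcap_mulset => // M _.
  by have [_ /conjsetE] := Fx M Logic.I.
by apply: trace_fromS (Xg M) => //; exact: mulset_subgroup.
Qed.

Lemma has_defect_propertyT : has_defect_property e [set: G].
Proof.
apply: open_has_defect_property; [exact: setT_subgroup|exact: openT|].
pose act (g : G) (x : unit) := x.
have <- : gstab act tt = [set: G] by apply/seteqP.
apply: (@trace_from_gstab _ _ _ _ act (fun=> e)) => //.
  by move=> g x; have /cgalg_centralP -> := block_central pe.
rewrite (big_pred1 tt)// => -[]; rewrite inE /= eqxx.
by apply/asboolP; exists 1%g.
Qed.

Lemma defect_group_exists : exists D, is_defect_group_idem e D.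
Proof.
pose T := {D : set G | has_defect_property e D}.
(* The order is reverse inclusion, so that a maximal element is a minimal subgroup. *)
pose R (D D' : T) := `[< sval D' `<=` sval D >].
have [||||[D dD] Dmin] := @Zorn T R.
- by move=> D; apply/asboolP.
- by move=> D1 D2 D3 /asboolP s12 /asboolP s23; apply/asboolP; exact: subset_trans s12.
- by move=> [D dD] [D' dD'] /asboolP /= s1 /asboolP /= s2; apply/eq_exist/seteqP.
- move=> C totC.
  have [[D0 CD0]|nC] := pselect (exists D : T, C D); last first.
    (* The empty chain is bounded by [G] itself. *)
    exists (exist _ _ has_defect_propertyT) => D CD; case: nC; by exists D.
  pose I := {D : T | C D}.
  pose F (i : I) := sval (sval i).
  have dF : has_defect_property e (\bigcap_i F i).
    apply: (has_defect_property_bigcap (exist _ D0 CD0 : I)).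
      by move=> [[D dD] CD].
    move=> i j; have [/asboolP ij|/asboolP ji] := totC _ _ (svalP i) (svalP j).
      by exists j => x Fx; split=> //; exact: ij.
    by exists i => x Fx; split=> //; exact: ji.
  exists (exist _ _ dF) => D CD; apply/asboolP => x /(_ (exist _ D CD)); exact.
exists D; split=> // D' dD' sD'.
have /(congr1 sval) : exist _ D' dD' = exist _ D dD :> T by apply/Dmin/asboolP.
exact.
Qed.

Lemma defect_group_conj D g :
  is_defect_group_idem e D -> is_defect_group_idem e (conjset g D).
Proof.
case=> dD minD; split; first exact: has_defect_property_conj.
move=> D' dD' sD'; rewrite -(conjsetKV g D'); congr conjset.
apply: minD; first exact: has_defect_property_conj.
by rewrite -(conjsetK g D); exact: conjsetS.
Qed.

(** Some [D'] meet [conjset g D] has the property. Minimality of [D'] puts [D'] inside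
    [conjset g D], and minimality of the latter gives equality. *)
Lemma defect_group_unique D D' :
    is_defect_group_idem e D -> is_defect_group_idem e D' ->
  exists g, D' = conjset g D.
Proof.
move=> dD dD'; have [g dI] := has_defect_property_meet dD'.1 dD.1.
exists g; have E := dD'.2 _ dI (@subIsetl _ _ _).
have [_ mingD] := defect_group_conj g dD.
apply: mingD; first exact: dD'.1.
by rewrite -E; exact: subIsetr.
Qed.

Lemma sylow_preimage_has_defect_property p N (P : {group quot N}) :
    p \in [pchar k] -> (p.-Sylow(setT_group (quot N)) P)%g ->
  has_defect_property e (quot_pi N @^-1` [set` P]).
Proof.
move=> kp sylP; set L := _ @^-1` _.
have sL : is_subgroup L.
  apply: is_subgroupP; first by rewrite /L /= quot_pi1 group1.
  move=> g h; rewrite /L /= => Pg Ph.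
  by rewrite quot_piM -quot_pi_inv groupM// groupV.
have NL : N `<=` L.
  move=> n Nn; rewrite /L /=; suff -> : quot_pi N n = 1%g by exact: group1.
  rewrite -(quot_pi1 N); apply/esym/quot_piP.
  by rewrite invg1 mul1g.
apply: open_has_defect_property => //; first exact: open_of_openNormal_sub NL.
rewrite -(gstab_coset_act sL NL).
have -> : quot_image N L = P.
  apply/setP => q; rewrite -[q]quot_reprK.
  by apply/idP/idP => [/(mem_quot_image _ sL NL)//|Pq]; apply/(mem_quot_image _ sL NL).
pose act := @coset_act G N.
have orbE : gorb act (P : {set quot N}) = lcosets P (setT_group (quot N)).
  apply/setP => C; apply/gorbP/lcosetsP => [[g ->]|[q _ ->]].
    by exists (quot_pi N g); rewrite // /act /coset_act lcosetE.
  by exists (quot_repr q); rewrite /act /coset_act quot_reprK lcosetE.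
have p_pr : prime p by exact: pcharf_prime kp.
(* The orbit of [P] is its set of left cosets, so [m] is the index of a Sylow [p]-subgroup, nonzero
   in [k]; the constant function [m^-1 *: e] then sums to [e]. *)
pose m : k := #|gorb act (P : {set quot N})|%:R.
have m0 : m != 0.
  rewrite /m orbE card_lcosets -(dvdn_pcharf kp).
  by rewrite -(p'natE _ p_pr); case/and3P: sylP.
apply: (@trace_from_gstab _ _ _ _ act (fun=> m^-1 *: e)).
- exact: coset_actP.
- move=> g x; rewrite /cgalg_conj -scalerAr -scalerAl.
  congr (_ *: _); symmetry.
  by have /cgalg_centralP := block_central pe; apply.
by rewrite sumr_const -scaler_nat scalerA mulfV// scale1r.
Qed.

Lemma defect_group_pro_p p D : p \in [pchar k] ->
  is_defect_group_idem e D -> pro_p_subgroup p D.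
Proof.
move=> kp [dD minD]; have [[sD cD] _] := dD; split=> // U sU UD _ [O oO UO].
have O1 : O 1%g by have := is_subgroup1 sU; rewrite UO => -[].
(* [U] is open in [D], so a small [N] meets [D] inside [U] and [D/U] can be counted in the finite
   group [quot N]. *)
have [N NO] := openNormal_basis oO O1.
have DNU : D `&` N `<=` U by rewrite UO; exact: setIS.
have [P sylP] := Sylow_exists p (setT_group (quot N)).
have dL := sylow_preimage_has_defect_property kp sylP.
have [g dI] := has_defect_property_meet dD dL.
(* By minimality [D] equals its intersection with a conjugate of the Sylow preimage, so its image in
   [quot N] is a [p]-group. *)
have DL : D `<=` conjset g (quot_pi N @^-1` [set` P]).
  by rewrite -(minD _ dI (@subIsetl _ _ _)); exact: subIsetr.
have [sDN NDN] := (mulset_subgroup N sD, @sub_mulset_openNormal _ D N sD).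
have [sUN NUN] := (mulset_subgroup N sU, @sub_mulset_openNormal _ U N sU).
pose Dg := Group (quot_image_group_set sDN NDN).
pose Ug := Group (quot_image_group_set sUN NUN).
have pD : (p.-group Dg)%g.
  apply: (@pgroupS _ _ (P :^ (quot_pi N g)^-1)%G); last first.
    by rewrite pgroupJ; exact: pHall_pgroup sylP.
  apply/fintype.subsetP => q; rewrite -[q]quot_reprK.
  move=> /(mem_quot_image _ sDN NDN)[d Dd [n Nn <-]].
  have -> : quot_pi N (d * n)%g = quot_pi N d.
    by apply/esym/quot_piP; rewrite mulKg.
  have /conjsetE := DL _ Dd; rewrite /= mem_conjgV conjgE.
  by rewrite !quot_piM -quot_pi_inv mulgA.
have /p_natP[n nE] : p.-nat #|Dg : Ug|%g by apply: pnat_dvd pD; exact: dvdn_indexg.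
exists n; rewrite -nE -(card_lcosets Dg Ug).
exact: card_left_cosets.
Qed.

End TracesOpen.

(** Each idempotent acts as the identity on its ideal; as each lies in the ideal of the other, both
    equal [e * f]. *)
Lemma block_ideal_inj (k : fieldType) (G : profiniteGroupType) (e f : cgalg k G) :
    central_idempotent e -> central_idempotent f ->
  block_ideal e = block_ideal f -> e = f.
Proof.
move=> [ce ee] [cf ff] ef.
have [x _ xf] : block_ideal f e by rewrite -ef; exists e.
have [y _ ye] : block_ideal e f by rewrite ef; exists f.
have -> : e = e * f by rewrite -xf -mulrA ff.
by rewrite ce -{1}ye -mulrA ee.
Qed.

Lemma block_idempotent_primitive (k : fieldType) (G : profiniteGroupType)
  (e : cgalg k G) : block_idempotent e -> primitive_central_idempotent e.
Proof. by case=> E [EP _ _] /EP. Qed.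

Theorem proposition5p7 (k : fieldType) (p : nat) (kp : p \in [pchar k])
    (G : profiniteGroupType) (B : set (cgalg k G)) (hB : is_block B) :
  (exists D0 : set G, defect_groups B = conjugacy_class D0) /\
  (forall D : set G, defect_groups B D -> pro_p_subgroup p D).
Proof.
have [e be Be] := hB; have pe := block_idempotent_primitive be.
(* [defect_groups] allows any block idempotent generating [B]; there is only one, so a single [e]
   can be fixed. *)
have dBP D : defect_groups B D <-> is_defect_group_idem e D.
  split=> [[f [bf Bf dD]]|dD]; last by exists e.
  suff -> : e = f by [].
  apply: block_ideal_inj; last by rewrite -Be.
    by have [] := pe.
  by have [] := block_idempotent_primitive bf.
split; last by move=> D /dBP; exact: defect_group_pro_p.
have [D0 dD0] := defect_group_exists pe; exists D0.
apply/seteqP; split=> [D /dBP dD|_ [g _ <-]].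
  by have [g ->] := defect_group_unique pe dD0 dD; exists g.
by apply/dBP; exact: defect_group_conj.
Qed.
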